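(* Let $\mathcal{H}$ be a toric hyperplane arrangement on the $n$-dimensional torus $T^n=\mathbb{R}^n/\mathbb{Z}^n$ that subdivides the torus into regions that are open $n$-dimensional balls. Then the number of regions in the complement $T^n-\bigcup_{H\in\mathcal{H}}H$ is $(-1)^n\cdot\chi(\mathcal{H};t=0)$.
   Context: A toric hyperplane is the image under the quotient map $\mathbb{R}^n\to\mathbb{R}^n/\mathbb{Z}^n$ of a hyperplane $\{\vec x:\vec a\cdot\vec x=b\}$ with $\vec a\in\mathbb{Q}^n\setminus\{0\}$, $b\in\mathbb{R}$; the image of a $k$-dimensional affine subspace with rational coefficient matrix is a $k$-dimensional toric subspace (a $k$-torus). A toric hyperplane arrangement is a finite collection $\{H_1,\dots,H_m\}$ of toric hyperplanes. Its intersection poset $\mathcal{P}$ consists of all connected components of all intersections $\bigcap_{i\in S}H_i$, $S\subseteq\{1,\dots,m\}$ (the empty intersection being $T^n$), together with $\emptyset$, ordered by reverse inclusion, with minimum $\hat0=T^n$. The toric characteristic polynomial is $\chi(\mathcal{H};t)=\sum_{x\in\mathcal{P},\,x\ne\emptyset}\mu(\hat0,x)\,t^{\dim x}$, with $\mu$ the Möbius function of $\mathcal{P}$. *)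

(* Defs.v *)
From HB Require Import structures.
From mathcomp Require Import all_boot all_order all_algebra.
From mathcomp Require Import finmap.
From mathcomp Require Import all_classical all_reals all_analysis.

Set Implicit Arguments.
Unset Strict Implicit.
Unset Printing Implicit Defensive.

Import Order.TTheory GRing.Theory Num.Theory.
Import numFieldNormedType.Exports.

Local Open Scope classical_set_scope.
Local Open Scope ring_scope.
Local Open Scope quotient_scope.

Section Torus.
Context (R : realType) (n : nat).

Definition lattice_rel : rel 'cV[R]_n :=
  fun x y => [forall i, x i 0 - y i 0 \is a Num.int].

Lemma lattice_rel_equiv : equiv_class_of lattice_rel.
Proof.
split=> [x|x y|y x z].
- by apply/forallP => i; rewrite subrr rpred0.
- by apply: eq_forallb => i; rewrite -opprB rpredN.
- move=> /forallP xy /forallP yz; apply/forallP => i.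
  by rewrite -(subrKA (y i 0)) rpredD.
Qed.

Canonical lattice_equiv_rel := EquivRelPack lattice_rel_equiv.

Definition torus : Type := quotient_topology {eq_quot lattice_equiv_rel}.

HB.instance Definition _ := Topological.copy torus
  (quotient_topology {eq_quot lattice_equiv_rel}).

Definition torus_proj : 'cV[R]_n -> torus :=
  \pi_(quotient_topology {eq_quot lattice_equiv_rel}).

Lemma torus_projP (x y : 'cV[R]_n) :
  torus_proj x = torus_proj y <->
  exists z : 'cV[int]_n, x - y = map_mx intr z.
Proof.
have -> : (torus_proj x = torus_proj y) <-> lattice_rel x y.
  by split=> [/eqmodP|xy]; last exact/eqmodP.
split=> [/forallP xy|[z xyz]].
  exists (map_mx Num.floor (x - y)); apply/matrixP => i j.
  by rewrite (ord1 j) !mxE floorK.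
apply/forallP => i; have := congr1 (fun M : 'cV_n => M i 0) xyz.
by rewrite !mxE => ->; rewrite intr_int.
Qed.

Definition toric_hyperplane (V : set torus) : Prop :=
  exists (a : 'cV[rat]_n) (b : R), a != 0 /\
    V = torus_proj @`
      [set x : 'cV[R]_n | \sum_(i < n) ratr (a i 0) * x i 0 = b].

(* A consistent system A x = c, with A of rank r, has an (n - r)-dimensional
   affine solution space. *)
Definition toric_subspace (k : nat) (V : set torus) : Prop :=
  exists (p : nat) (A : 'M[rat]_(p, n)) (c : 'cV[R]_p),
    let L := [set x : 'cV[R]_n | map_mx ratr A *m x = c] in
    [/\ L !=set0, k = (n - \rank A)%N & V = torus_proj @` L].

(* The dimension of a toric subspace is unique; 0 is the (unused) value on
   sets that are not toric subspaces. *)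
Definition toric_dim (V : set torus) : nat :=
  xget 0%N [set k | toric_subspace k V].

Definition unit_ball : set 'cV[R]_n :=
  [set x | \sum_(i < n) x i 0 ^+ 2 < 1].

End Torus.

Arguments unit_ball : clear implicits.

Definition components (X : topologicalType) (A : set X) : set (set X) :=
  connected_component A @` A.

Definition homeomorphic (X Y : topologicalType) (A : set X) (B : set Y) :=
  exists (f : X -> Y) (g : Y -> X),
    [/\ f @` A `<=` B, g @` B `<=` A,
        (forall x, A x -> g (f x) = x), (forall y, B y -> f (g y) = y) &
        {within A, continuous f} /\ {within B, continuous g}].

Section Mobius.
Context (X : choiceType) (P : set X) (le : X -> X -> Prop).

(* The recursion mu(x, x) = 1, mu(x, y) = - sum_(x <= z < y) mu(x, z).  It goes
   down along chains of P, so that #|P| is enough fuel (see mobiusE). *)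
Fixpoint mobius_rec (k : nat) (x y : X) : int :=
  if k is k'.+1 then
    if x == y then 1
    else - \sum_(z \in [set z | [/\ P z, le x z, le z y & z <> y]])
             mobius_rec k' x z
  else 0.

Definition mobius : X -> X -> int := mobius_rec #|` fset_set P|%fset.

Hypotheses (finP : finite_set P) (le_refl : forall x, le x x)
  (le_anti : forall x y, le x y -> le y x -> x = y)
  (le_trans : forall x y z, le x y -> le y z -> le x z).

Let down (y : X) := fset_set [set z | P z /\ le z y].

Let in_down y z : (z \in down y) = `[< P z /\ le z y >].
Proof.
rewrite in_fset_set; last by apply: sub_finite_set finP => ? [].
by apply/idP/asboolP; rewrite inE.
Qed.

Let down_lt y z : P y -> le z y -> z <> y ->
  (#|` down z| < #|` down y|)%N.
Proof.
move=> Py zy nzy; apply: fproper_ltn_card; rewrite fproperE; apply/andP; split.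
  apply/fsubsetP => w; rewrite !in_down => /asboolP[Pw wz].
  by apply/asboolP; split=> //; exact: le_trans zy.
apply/negP => /fsubsetP /(_ y); rewrite !in_down => yz.
have /asboolP[_ /le_anti] : `[< P y /\ le y z >] by apply/yz/asboolP.
by move=> /(_ zy) /esym.
Qed.

Let mobius_rec_stable k x y : P y -> (#|` down y| <= k)%N ->
  mobius_rec k.+1 x y = mobius_rec k x y.
Proof.
elim: k y => [|k IH] y Py hk.
  have : y \in down y by rewrite in_down; apply/asboolP.
  by move: hk; rewrite leqn0 cardfs_eq0 => /eqP ->; rewrite in_fset0.
rewrite -[LHS]/(if x == y then 1 else - \sum_(z \in _) mobius_rec k.+1 x z).
rewrite -[RHS]/(if x == y then 1 else - \sum_(z \in _) mobius_rec k x z).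
case: ifP => // _; congr (- _); apply: eq_fsbigr => z.
rewrite inE => -[Pz xz zy nzy].
by apply: IH => //; rewrite -ltnS; apply: leq_trans hk; exact: down_lt.
Qed.

Lemma mobiusE x y : P y ->
  mobius x y = if x == y then 1
    else - \sum_(z \in [set z | [/\ P z, le x z, le z y & z <> y]]) mobius x z.
Proof.
move=> Py; rewrite {1}/mobius -mobius_rec_stable //.
apply: fsubset_leq_card; apply/fsubsetP => z; rewrite in_down => /asboolP[Pz _].
by rewrite in_fset_set // inE.
Qed.

End Mobius.

Section Arrangement.
Context (R : realType) (n m : nat) (H : 'I_m -> set (torus R n)).

Definition intersection_poset : set (set (torus R n)) :=
  [set C | C = set0 \/
     exists S : {set 'I_m}, components (\bigcap_(i in [set` S]) H i) C].

Definition rev_incl (x y : set (torus R n)) : Prop := y `<=` x.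

Definition toric_char_poly : {poly int} :=
  \sum_(x \in intersection_poset `\ set0)
    mobius intersection_poset rev_incl setT x *: 'X^(toric_dim x).

Definition regions : set (set (torus R n)) :=
  components (~` \bigcup_i H i).

End Arrangement.

(* Main.v *)
Require Import Defs.
From mathcomp Require Import all_boot all_order all_algebra.
From mathcomp Require Import finmap.
From mathcomp Require Import all_classical all_reals all_analysis.
From mathcomp Require Import lra zify ring.
Import Order.TTheory GRing.Theory Num.Theory.
Import numFieldNormedType.Exports.
Local Open Scope classical_set_scope.
Local Open Scope ring_scope.

Set Implicit Arguments.
Unset Strict Implicit.
Unset Printing Implicit Defensive.

(* Integrating coordinate by coordinate, an integer-valued function on the
   circle being sent to the sum of its jumps [g t - g (t+)], gives an
   additive functional on tame functions on the torus, the Euler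
   characteristic with compact supports. It is 1 on a point, 0 on a subtorus
   of positive dimension and (-1)^n on the projection of a bounded open
   convex set that injects into the torus, because the nonempty slices of
   such a set lie over an open interval and are again of this kind.

   Moebius inversion writes the indicator of the complement of the arrangement
   as the sum of [mu C * 1_C] over the strata [C], so the Euler
   characteristic of the complement is the value at 0 of the characteristic
   polynomial. The complement is also the disjoint union of the regions,
   which are projections of open polyhedra; when these are bounded, each
   region contributes (-1)^n.

   A polyhedron whose region is a ball is indeed bounded: otherwise the normals
   of the hyperplanes do not span, the polyhedron is invariant under a
   nonzero integral translation, and the region contains a closed line, which
   is not contractible in the torus as it winds around some coordinate
   circle. *)

Local Notation "\chi_ A" := (@indic _ int A) (at level 8, A at level 2).

(** * Indicators, column vectors and integral matrices *)

Section Indicators.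
Context {S : pzRingType}.

Lemma indic_mem (T : Type) (A : set T) x : A x -> \1_A x = 1 :> S.
Proof. by move=> Ax; rewrite indicE mem_set. Qed.

Lemma indic_memN (T : Type) (A : set T) x : ~ A x -> \1_A x = 0 :> S.
Proof. by move=> Ax; rewrite indicE memNset. Qed.

Lemma eq_indic (T U : Type) (A : set T) (B : set U) x y :
  (A x <-> B y) -> \1_A x = \1_B y :> S.
Proof.
move=> AB; have [Ax|nAx] := pselect (A x).
  by rewrite !indic_mem //; apply/AB.
by rewrite !indic_memN // => /AB.
Qed.

Lemma fsum_indic_trivIset (T : Type) (I : choiceType)
    (D : set I) (F : I -> set T) (x : T) : trivIset D F ->
  \sum_(i \in D) (\1_(F i) x : S) = \1_(\bigcup_(i in D) F i) x.
Proof.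
move=> tF; have [[i Di Fix]|nF] := pselect ((\bigcup_(i in D) F i) x);
  last first.
  rewrite [RHS]indic_memN // fsbig1 // => i Di.
  by rewrite indic_memN // => Fix; apply: nF; exists i.
rewrite [RHS]indic_mem; last by exists i.
rewrite -(fsbig_widen [set i]); first by rewrite fsbig_set1 indic_mem.
- by move=> _ ->.
- move=> j /= [Dj ji]; rewrite indic_memN // => Fjx; apply: ji.
  by apply: tF => //; exists x.
Qed.

Lemma fsum_indic_set1 (T : choiceType) (A : set T) (x : T) :
  \sum_(y \in A) (\1_[set y] x : S) = \1_A x.
Proof.
rewrite fsum_indic_trivIset; last by move=> y z _ _ [_ [-> ->]].
by rewrite bigcup_imset1 image_id.
Qed.

Lemma fsum_indic_components (T : topologicalType) (A : set T)
    (x : T) :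
  \sum_(C \in components A) (\1_C x : S) = \1_A x.
Proof.
rewrite (@fsum_indic_trivIset _ _ _ id);
  first by rewrite connected_component_cover.
move=> _ _ [y _ <-] [z _ <-] [w [/same_connected_component ->]].
by move=> /same_connected_component ->.
Qed.

End Indicators.

Lemma finite_int_norm_le (R : archiRealDomainType) (B : R) :
  finite_set [set z : int | `|z%:~R| <= B].
Proof.
pose N := `|Num.floor B|%N.
have fin := finite_image (fun i : nat => i%:Z - N%:Z) (finite_II N.*2.+1).
apply: sub_finite_set fin => z /=; rewrite -intr_norm -floor_ge_int => zN.
by exists `|(z + N%:Z)%R|%N => /=; lia.
Qed.

Section ColumnCons.
Context (T : Type).

Definition cvcons n (t : T) (x : 'cV[T]_n) : 'cV[T]_n.+1 :=
  \col_i oapp (x^~ 0) t (unlift 0 i).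

Lemma cvcons0 n t (x : 'cV[T]_n) : cvcons t x 0 0 = t.
Proof. by rewrite mxE unlift_none. Qed.

Lemma cvcons_lift n t (x : 'cV[T]_n) i : cvcons t x (lift 0 i) 0 = x i 0.
Proof. by rewrite mxE liftK. Qed.

Lemma row'_cvcons n t (x : 'cV[T]_n) : row' 0 (cvcons t x) = x.
Proof. by apply/colP => i; rewrite mxE cvcons_lift. Qed.

Lemma cvcons_eta n (x : 'cV[T]_n.+1) : cvcons (x 0 0) (row' 0 x) = x.
Proof.
apply/colP => i; case: (unliftP 0 i) => [j|] ->; last by rewrite cvcons0.
by rewrite cvcons_lift mxE.
Qed.

Lemma cvcons_inj n t t' (x x' : 'cV[T]_n) :
  cvcons t x = cvcons t' x' -> t = t' /\ x = x'.
Proof.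
move=> E; split; first by rewrite -(cvcons0 t x) E cvcons0.
by rewrite -(row'_cvcons t x) E row'_cvcons.
Qed.

End ColumnCons.

Lemma map_cvcons (T U : Type) (f : T -> U) n t (x : 'cV[T]_n) :
  map_mx f (cvcons t x) = cvcons (f t) (map_mx f x).
Proof.
apply/colP => i; rewrite !mxE.
by case: (unlift 0 i) => //= j; rewrite mxE.
Qed.

Lemma cvconsD (V : nmodType) n (t t' : V) (x x' : 'cV[V]_n) :
  cvcons t x + cvcons t' x' = cvcons (t + t') (x + x').
Proof.
apply/colP => i; rewrite !mxE.
by case: (unlift 0 i) => //= j; rewrite mxE.
Qed.

Lemma cvcons_zero (V : nmodType) n : cvcons 0 0 = 0 :> 'cV[V]_n.+1.
Proof.
apply/colP => i; rewrite !mxE.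
by case: (unlift 0 i) => //= j; rewrite mxE.
Qed.

Lemma scale_cvcons (S : pzSemiRingType) n c t (x : 'cV[S]_n) :
  c *: cvcons t x = cvcons (c * t) (c *: x).
Proof.
apply/colP => i; rewrite !mxE.
by case: (unlift 0 i) => //= j; rewrite mxE.
Qed.

Lemma mulmx_cvcons (S : comPzRingType) p n (A : 'M[S]_(p, n.+1)) t
    (x : 'cV[S]_n) :
  A *m cvcons t x = t *: col 0 A + col' 0 A *m x.
Proof.
apply/colP => i; rewrite !mxE big_ord_recl cvcons0 mulrC; congr (_ + _).
by apply: eq_bigr => j _; rewrite cvcons_lift mxE.
Qed.

Lemma finite_cV (T : Type) n (A : set T) :
  finite_set A -> finite_set [set x : 'cV[T]_n | forall i, A (x i 0)].
Proof.
move=> finA; elim: n => [|n IH].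
  have [[x0]|no] := pselect (inhabited 'cV[T]_0); last first.
    by apply: (sub_finite_set _ (finite_set0 _)) => x _; exact: no (inhabits x).
  by apply: (sub_finite_set _ (finite_set1 x0)) => x _; apply/colP => -[].
apply: sub_finite_set (finite_image2 (@cvcons T n) finA IH) => x Ax /=.
exists (x 0 0) => //; exists (row' 0 x); last exact: cvcons_eta.
by move=> i /=; rewrite mxE.
Qed.

Lemma row_fullPn (F : fieldType) p n (A : 'M[F]_(p, n)) :
  reflect (exists2 x : 'cV_n, x != 0 & A *m x = 0) (~~ row_full A).
Proof.
rewrite /row_full -mxrank_tr -/(row_free A^T) -kermx_eq0.
apply: (iffP rowV0Pn) => [[v /sub_kermxP vA v0]|[x x0 Ax]].
  by exists v^T; [rewrite trmx_eq0|rewrite -[A]trmxK -trmx_mul vA trmx0].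
by exists x^T; [apply/sub_kermxP; rewrite -trmx_mul Ax trmx0|rewrite trmx_eq0].
Qed.

Lemma col_mem_image_col' (F : fieldType) p n (A : 'M[F]_(p, n.+1)) :
  row_full (col' 0 A) -> ~~ row_full A ->
  exists q : 'cV_n, col 0 A = col' 0 A *m q.
Proof.
move=> full' /row_fullPn[x x0]; rewrite -(cvcons_eta x) mulmx_cvcons.
move: (x 0 0) (row' 0 x) (cvcons_eta x) => t y xE ty0.
have t0 : t != 0.
  apply: contra_neq x0 => t0; move: ty0; rewrite t0 scale0r add0r.
  rewrite -[RHS](mulmx0 _ (col' 0 A)) => /(row_full_inj full') y0.
  by rewrite -xE t0 y0 cvcons_zero.
exists (- t^-1 *: y); rewrite -scalemxAr -(addr0_eq ty0).
by rewrite scaleNr scalerN opprK scalerA mulVf // scale1r.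
Qed.

Lemma map_intr_inj (F : numDomainType) m n :
  injective (map_mx (intr : int -> F) : 'M[int]_(m, n) -> 'M[F]_(m, n)).
Proof.
move=> A B /matrixP AB; apply/matrixP => i j.
by apply: (@intr_inj F); have := AB i j; rewrite !mxE.
Qed.

Lemma clear_denominators m n (A : 'M[rat]_(m, n)) :
  exists2 d : int, d != 0 &
    exists B : 'M[int]_(m, n), map_mx intr B = d%:~R *: A.
Proof.
exists (\prod_ij denq (A ij.1 ij.2)).
  by apply/prodf_neq0 => ij _; exact: denq_neq0.
exists (\matrix_(i, j) (numq (A i j) *
  \prod_(kl | kl != (i, j)) denq (A kl.1 kl.2))).
apply/matrixP => i j; rewrite !mxE [X in _ = X%:~R * _](bigD1 (i, j)) //=.
by rewrite !intrM numqE; ring.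
Qed.

Lemma int_rV_primitive n (c : 'rV[int]_n) : c != 0 ->
  exists (d : int) (r : 'rV[int]_n) (z : 'cV[int]_n),
    [/\ d != 0, c = d *: r & r *m z = 1%:M].
Proof.
case: n c => [|n] c c0; first by rewrite (thinmx0 c) eqxx in c0.
have [L _ [Q Qu [d _ cE]]] := int_Smith_normal_form c.
pose e := L 0 0 * d`_0.
have {}cE : c = e *: row 0 Q.
  rewrite {1}cE [L]mx11_scalar (_ : \matrix_(i, j) _ = d`_0 *: delta_mx 0 0).
    by rewrite mul_scalar_mx -scalemxAl -scalemxAl scalerA -rowE.
  by apply/rowP => j; rewrite !mxE mulr_natr eq_sym.
exists e, (row 0 Q), (col 0 (invmx Q)); split=> //.
  by apply: contra_neq c0; rewrite cE => ->; rewrite scale0r.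
rewrite colE mulmxA -row_mul mulmxV // rowE mulmx1 mul_delta_mx.
by apply/matrixP => i j; rewrite !mxE !ord1.
Qed.

Lemma rat_cV_primitive n (u : 'cV[rat]_n) : u != 0 ->
  exists (c : rat) (r : 'rV[int]_n) (z : 'cV[int]_n),
    [/\ c != 0, u^T = c *: map_mx intr r & r *m z = 1%:M].
Proof.
move=> u0; have [d d0 [c cE]] := clear_denominators u.
have d0Q : d%:~R != 0 :> rat by rewrite intr_eq0.
have c0 : c^T != 0.
  rewrite trmx_eq0; apply: contra_neq u0 => c0; apply: (scalerI d0Q).
  by rewrite -cE c0 map_mx0 scaler0.
have [e [r [z [e0 crE rz]]]] := int_rV_primitive c0.
exists (e%:~R / d%:~R), r, z; split=> //.
  by rewrite mulf_neq0 ?invr_eq0 ?intr_eq0.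
apply: (scalerI d0Q); rewrite -linearZ /= -cE map_trmx crE scalerA.
by rewrite mulrCA divff // mulr1; apply/matrixP => i j; rewrite !mxE intrM.
Qed.

Lemma intr_neq_half (F : numFieldType) (k : int) : k%:~R <> 2^-1 :> F.
Proof.
move=> kE; have /intr_inj : (2 * k)%:~R = 1%:~R :> F by rewrite intrM kE mulfV.
by lia.
Qed.

Section RationalRank.
Context {F : numFieldType}.

Lemma mxrank_intr p n (a : 'M[int]_(p, n)) :
  \rank (map_mx intr a : 'M[F]_(p, n)) = \rank (map_mx intr a : 'M[rat]_(p, n)).
Proof.
rewrite -(mxrank_map (@ratr F)); congr mxrank.
by apply/matrixP => i j; rewrite !mxE rmorph_int.
Qed.

Lemma integral_kernel p n (a : 'M[int]_(p, n)) :
  ~~ row_full (map_mx intr a : 'M[F]_(p, n)) ->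
  exists2 v : 'cV[int]_n, v != 0 & a *m v = 0.
Proof.
rewrite /row_full mxrank_intr => /row_fullPn[u u0 au].
have [d d0 [v vE]] := clear_denominators u; exists v.
  apply: contra_neq u0 => v0; apply: (scalerI (_ : d%:~R != 0 :> rat)).
    by rewrite intr_eq0.
  by rewrite -vE v0 map_mx0 scaler0.
by apply: (@map_intr_inj rat); rewrite map_mxM vE -scalemxAr au scaler0 map_mx0.
Qed.

End RationalRank.

Section MobiusSum.
Context (X : choiceType) (P : set X) (le : X -> X -> Prop).
Hypotheses (finP : finite_set P) (le_refl : forall x, le x x)
  (le_anti : forall x y, le x y -> le y x -> x = y)
  (le_trans : forall x y z, le x y -> le y z -> le x z).

Lemma fsum_mobius x y : P y -> le x y ->
  \sum_(z \in [set z | [/\ P z, le x z & le z y]]) mobius P le x z =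
    (x == y)%:Z.
Proof.
move=> Py xy; set D := [set z | _].
have finD : finite_set D by apply: sub_finite_set finP => z [].
have DE : D `\ y = [set z | [/\ P z, le x z, le z y & z <> y]].
  by apply/seteqP; split=> z; [move=> [[]]|move=> []].
rewrite (fsbigD1 y) //= DE mobiusE //; case: eqVneq => [xy_eq|_]; last first.
  by rewrite addNr.
rewrite fsbig1 ?addr0 // => z [_ xz zy nzy].
by case: nzy; apply: le_anti => //; rewrite -xy_eq.
Qed.

End MobiusSum.

(** * Connected and convex sets *)

Lemma connected_component_open_partition (X : topologicalType)
    (A B U V : set X) x :
  connected B -> B x -> open U -> open V -> A `&` U = B -> A `&` V = A `\` B ->
  connected_component A x = B.
Proof.
move=> cB Bx oU oV AU AV; have BA : B `<=` A by rewrite -AU; exact: subIsetl.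
apply/seteqP; split; last exact: connected_component_max.
set D := connected_component A x.
have DA : D `<=` A by exact: connected_component_sub.
have DU : D `&` U = D `&` B by rewrite -AU setIA (setIidl DA).
suff <- : D `&` U = D by rewrite DU; exact: subIsetr.
have cD : connected D by exact: component_connected.
apply: cD; last 2 first.
- by exists U.
- exists (~` V); first exact: open_closedC.
  apply/seteqP; rewrite DU; split=> y [Dy]; have Ay := DA _ Dy.
    by move=> By; split=> // Vy; have [] : (A `\` B) y by rewrite -AV.
  move=> nVy; split=> //; apply: contrapT => nBy; apply: nVy.
  by have [] : (A `&` V) y by rewrite AV.
- rewrite DU; exists x; split=> //.
  by apply: connected_component_refl; exact: BA.
Qed.

Lemma continuous_within_comp (X Y Z : topologicalType) (A : set Y)
    (h : X -> Y) (f : Y -> Z) :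
  continuous h -> (forall x, A (h x)) -> {within A, continuous f} ->
  continuous (f \o h).
Proof.
move=> ch Ah /subspace_continuousP cf x V /(cf _ (Ah x)).
rewrite /= => /ch; rewrite nbhs_simpl /=; apply: filterS => y /=; exact.
Qed.

Lemma mx_continuous (X T : topologicalType) m n (f : X -> 'M[T]_(m, n)) :
  (forall i j, continuous (fun x => f x i j)) -> continuous f.
Proof.
move=> cf x V [P nP PV]; rewrite nbhs_simpl /=.
have : \forall y \near x, forall i j, P i j (f y i j).
  by do 2 apply: filter_forall => ?; apply: cf; exact: nP.
by apply: filterS => y Py; exact: PV.
Qed.

Lemma mulmx_continuous (R : numFieldType) m n p (A : 'M[R]_(m, n)) :
  continuous (fun B : 'M[R]_(n, p) => A *m B).
Proof.
apply: mx_continuous => i j.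
rewrite (_ : (fun B => _) = fun B : 'M[R]_(n, p) => \sum_k A i k * B k j);
  last first.
  by apply/funext => B; rewrite mxE.
apply: (continuous_big (op := +%R)) => [|k _]; first exact: add_continuous.
by move=> B; apply: continuousM;
  [exact: cst_continuous|exact: coord_continuous].
Qed.

Lemma cvcons_continuousl (T : topologicalType) n (x : 'cV[T]_n) :
  continuous (fun t : T => cvcons t x).
Proof.
apply: mx_continuous => i j.
rewrite (_ : (fun t => _) = oapp (fun k => cst (x k 0)) id (unlift 0 i)).
  by case: (unlift 0 i) => [k|] /= t; [exact: cvg_cst|exact: cvg_id].
by apply/funext => t; rewrite mxE; case: (unlift 0 i).
Qed.

Lemma cvcons_continuousr (K : numFieldType) n (t : K) :
  continuous (@cvcons K n t).
Proof.
apply: mx_continuous => i j.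
rewrite (_ : (fun x => _) =
    oapp (fun k => (fun x : 'cV[K]_n => x k 0)) (cst t) (unlift 0 i)).
  by case: (unlift 0 i) => [k|];
    [exact: coord_continuous|exact: cst_continuous].
by apply/funext => x; rewrite mxE; case: (unlift 0 i).
Qed.

Lemma open_box (T : topologicalType) p (B : 'I_p -> set T) :
  (forall i, open (B i)) -> open [set y : 'cV[T]_p | forall i, B i (y i 0)].
Proof.
move=> oB; rewrite openE => y By; exists (fun i _ => B i).
  by move=> i j; rewrite (ord1 j); apply: open_nbhs_nbhs.
by move=> y' By' i; exact: By'.
Qed.

Lemma convex_comb_itv (R : realFieldType) (l u x y s : R) :
  l < x < u -> l < y < u -> 0 <= s <= 1 -> l < s * x + (1 - s) * y < u.
Proof.
wlog xy : x y s / x <= y => [wlog_le|lx uy s01].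
  have [|/ltW yx lx uy s01] := leP x y; first exact: wlog_le.
  rewrite (_ : s * x + _ = (1 - s) * y + (1 - (1 - s)) * x); last by ring.
  by apply: wlog_le => //; lra.
have : 0 <= s * (y - x) by apply: mulr_ge0; lra.
have : 0 <= (1 - s) * (y - x) by apply: mulr_ge0; lra.
by lra.
Qed.

Lemma convex_setP (R : realDomainType) (V : lmodType R) (U : set V) :
  convex_set U <-> forall x y (s : R),
    U x -> U y -> 0 <= s <= 1 -> U (s *: x + (1 - s) *: y).
Proof.
split=> [cU x y s Ux Uy s01|cU x y s].
  have s_itv : Itv.spec (@Itv.num_sem R) (Itv.Real `[0, 1]%Z) s.
    by case/andP: s01 => s0 s1;
      rewrite /= /Itv.num_sem num_real /= in_itv /= s0 s1.
  by have := cU x y (Itv.mk s_itv); rewrite !inE; exact.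
by rewrite !inE => Ux Uy; apply: cU => //; rewrite ge0 le1.
Qed.

Lemma convex_connected (R : realType) (V : normedModType R) (U : set V) :
  convex_set U -> connected U.
Proof.
move=> /convex_setP cU; have [->|/set0P[y Uy]] := eqVneq U set0.
  exact: connected0.
pose segment x := (fun s : R => s *: x + (1 - s) *: y) @` `[0, 1]%classic.
have -> : U = \bigcup_(x in U) segment x.
  apply/seteqP; split=> [x Ux|_ [x Ux] [s /= s01 <-]].
    exists x => //; exists 1; first by rewrite /= in_itv /= ler01 lexx.
    by rewrite subrr scale0r scale1r addr0.
  by apply: cU => //; move: s01; rewrite in_itv.
apply: bigcup_connected.
  exists y => x Ux; exists 0; first by rewrite /= in_itv /= lexx ler01.
  by rewrite scale0r subr0 scale1r add0r.
move=> x Ux; apply: connected_continuous_connected;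
  first exact: segment_connected.
apply: continuous_subspaceT => s; apply: cvgD; apply: cvgZr_tmp;
  first exact: cvg_id.
by apply: cvgB; [exact: cvg_cst|exact: cvg_id].
Qed.

Lemma open_bounded_interval (R : realType) (I : set R) (M : R) :
  open I -> is_interval I -> I !=set0 -> (forall t, I t -> `|t| <= M) ->
  exists a b, [/\ a < b, `|a| <= M & I = `]a, b[%classic].
Proof.
move=> oI iI [t It] bI.
have lbI : lbound I (- M) by move=> s /bI; rewrite ler_norml => /andP[].
have ubI : ubound I M by move=> s /bI; rewrite ler_norml => /andP[].
have IE : I = `]inf I, sup I[%classic.
  rewrite -[LHS](interior_id I).1 // interval_bounded_interior //.
  - by exists (- M).
  - by exists M.
have /andP[at_ tb] : inf I < t < sup I by move: It; rewrite {1}IE /= in_itv.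
exists (inf I), (sup I); split=> //; first exact: lt_trans tb.
rewrite ler_norml; apply/andP; split; first by apply: lb_le_inf => //; exists t.
by apply: (le_trans (ltW at_)); exact: ubI.
Qed.

(** * Integration over the circle and the torus *)

Section CircleEuler.
Context {R : realType}.
Implicit Types (g : R -> int) (t s : R).

Definition fundamental_interval : set R := [set t | 0 <= t < 1].

(* The sum of the jumps [g t - g (t+)] of [g] over the fundamental domain [0, 1)
   of the circle. *)
Definition circle_euler g (e : int) : Prop :=
  exists gr : R -> int,
    [/\ forall t, fundamental_interval t -> \forall s \near t^'+, g s = gr t,
        finite_set (fundamental_interval `&` [set t | g t != gr t]) &
        e = \sum_(t \in fundamental_interval) (g t - gr t)].

Lemma near_right_fundamental_interval t :
  fundamental_interval t -> \forall s \near t^'+, fundamental_interval s.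
Proof.
move=> /andP[t0 t1]; near=> s; apply/andP; split.
  by apply: le_trans t0 _; near: s; exact: nbhs_right_ge.
by near: s; exact: nbhs_right_lt.
Unshelve. all: by end_near. Qed.

Lemma eq_circle_euler g g' e : {in fundamental_interval, g =1 g'} ->
  circle_euler g e -> circle_euler g' e.
Proof.
move=> gg' [gr [lim fin ->]]; exists gr; split.
- move=> t t01; near=> s; rewrite -gg'; first by near: s; exact: lim.
  by rewrite inE; near: s; exact: near_right_fundamental_interval.
- by apply: sub_finite_set fin => t [t01] /=; rewrite gg' ?inE.
- by apply: eq_fsbigr => t t01; rewrite gg'.
Unshelve. all: by end_near. Qed.

Lemma circle_euler_unique g e e' :
  circle_euler g e -> circle_euler g e' -> e = e'.
Proof.
move=> [gr [lim _ ->]] [gr' [lim' _ ->]]; apply: eq_fsbigr => t.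
rewrite inE => t01; congr (_ - _).
near t^'+ => s; transitivity (g s); last by near: s; exact: lim'.
by apply/esym; near: s; exact: lim.
Unshelve. all: by end_near. Qed.

Lemma circle_eulerD g g' e e' : circle_euler g e -> circle_euler g' e' ->
  circle_euler (g \+ g') (e + e').
Proof.
move=> [gr [lim fin ->]] [gr' [lim' fin' ->]].
pose D := fundamental_interval `&`
  ([set t | g t != gr t] `|` [set t | g' t != gr' t]).
have finD : finite_set D by rewrite /D setIUr finite_setU.
have restrict (h h' : R -> int) :
    [set t | h t != h' t] `<=`
      [set t | g t != gr t] `|` [set t | g' t != gr' t] ->
  \sum_(t \in fundamental_interval) (h t - h' t) = \sum_(t \in D) (h t - h' t).
  move=> hD; apply/esym/fsbig_widen; first exact: subIsetl.
  move=> t /= [t01 nDt]; apply/eqP; rewrite subr_eq0; apply/negPn/negP => ne.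
  by apply: nDt; split=> //; exact: hD.
have supp : [set t | (g \+ g') t != (gr \+ gr') t] `<=`
    [set t | g t != gr t] `|` [set t | g' t != gr' t].
  move=> t; apply: contraPP => /not_orP[/negP/negPn/eqP E /negP/negPn/eqP E'].
  by rewrite /= E E' eqxx.
exists (gr \+ gr'); split.
- by move=> t t01; apply: filterS2 (lim t t01) (lim' t t01) => s /= -> ->.
- by apply: sub_finite_set finD => t [t01 /supp].
- rewrite !restrict //; do ?by move=> t; [left|right].
  rewrite -fsbig_split //; apply: eq_fsbigr => t _ /=.
  by rewrite opprD addrACA.
Qed.

Lemma circle_eulerM c g e :
  circle_euler g e -> circle_euler (fun t => c * g t) (c * e).
Proof.
move=> [gr [lim fin ->]]; exists (fun t => c * gr t); split.
- by move=> t /lim; apply: filterS => s ->.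
- apply: sub_finite_set fin => t [t01 ne]; split=> //.
  by apply: contra_neq ne => ->.
- by rewrite mulr_fsumr; apply: eq_fsbigr => t _; rewrite mulrBr.
Qed.

Lemma circle_euler_cst c : circle_euler (fun=> c) 0.
Proof.
exists (fun=> c); split=> //; last by rewrite fsbig1 // => t _; rewrite subrr.
- by move=> t _; exact: nearW.
- by apply: (sub_finite_set _ (finite_set0 _)) => t [_ /eqP].
Qed.

Lemma circle_euler_fsum (I : choiceType) (D : set I) (g : I -> R -> int) e :
  finite_set D -> (forall i, D i -> circle_euler (g i) (e i)) ->
  circle_euler (fun t => \sum_(i \in D) g i t) (\sum_(i \in D) e i).
Proof.
move=> finD gD; rewrite fsbig_finite //.
rewrite (_ : (fun t => _) = \sum_(i <- fset_set D) g i); last first.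
  by rewrite fct_sumE; apply/funext => t; rewrite fsbig_finite.
rewrite !big_seq; apply: (big_ind2 circle_euler).
- exact: circle_euler_cst.
- by move=> g1 e1 g2 e2; exact: circle_eulerD.
- by move=> i; rewrite in_fset_set // inE; exact: gD.
Qed.

Lemma circle_euler_jump g gr p :
  (forall t, fundamental_interval t -> \forall s \near t^'+, g s = gr t) ->
  (forall t, t != p -> g t = gr t) ->
  circle_euler g (\chi_fundamental_interval p * (g p - gr p)).
Proof.
move=> lim off; exists gr; split=> //.
  apply: (sub_finite_set _ (finite_set1 p)) => t [_ /=].
  by apply: contraNP => /eqP tp; rewrite off.
have [p01|p01] := pselect (fundamental_interval p).
  rewrite indic_mem // mul1r -(fsbig_widen [set p]) ?fsbig_set1 //.
    by move=> _ ->.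
  by move=> t /= [_ /eqP tp]; rewrite off ?subrr.
rewrite indic_memN // mul0r fsbig1 // => t t01.
by rewrite off ?subrr //; apply: contra_not_neq p01 => <-.
Qed.

Lemma circle_euler_point p :
  fundamental_interval p -> circle_euler \chi_[set p] 1.
Proof.
move=> p01.
have -> : 1 = \chi_fundamental_interval p * (\chi_[set p] p - 0).
  by rewrite !indic_mem // subr0 mulr1.
apply: (@circle_euler_jump _ (fun=> 0)) => [t _|t tp]; last first.
  by rewrite indic_memN // => /= E; rewrite E eqxx in tp.
have [tp|pt] := ltP t p; near=> s; rewrite indic_memN //; apply/eqP.
  by rewrite lt_eqF //; near: s; exact: nbhs_right_lt.
by rewrite gt_eqF // (le_lt_trans pt) //; near: s; exact: nbhs_right_gt.
Unshelve. all: by end_near. Qed.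

Lemma circle_euler_itv (a b : R) : a < b ->
  circle_euler \chi_`]a, b[%classic (- \chi_fundamental_interval a).
Proof.
move=> ab; rewrite (_ : - _ = \chi_fundamental_interval a *
    (\chi_`]a, b[%classic a - \chi_`[a, b[%classic a)); last first.
  by rewrite !indicE !mem_setE !in_itv /= lexx ltxx ab sub0r mulrN1.
apply: circle_euler_jump => [t _|t ta].
  have [ta|at_] := ltP t a; first near=> s.
    rewrite !indicE !mem_setE !in_itv /= (leNgt a) ta ltNge.
    by rewrite (_ : s <= a) //; near: s; exact: nbhs_right_le.
  have [tb|bt] := ltP t b; near=> s; rewrite !indicE !mem_setE !in_itv /= at_.
    rewrite tb (le_lt_trans at_) /=; last by near: s; exact: nbhs_right_gt.
    by rewrite (_ : s < b) //; near: s; exact: nbhs_right_lt.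
  rewrite !ltNge bt (le_trans bt) ?andbF //; near: s; exact: nbhs_right_ge.
by rewrite !indicE !mem_setE !in_itv /= lt_neqAle eq_sym ta.
Unshelve. all: by end_near. Qed.

End CircleEuler.
Arguments fundamental_interval : clear implicits.

Section TorusProjection.
Context {R : realType} {n : nat}.
Implicit Types (x y v : 'cV[R]_n) (z : 'cV[int]_n) (q : torus R n).
Local Notation mxR := (map_mx (intr : int -> R)).
Local Notation proj := (@torus_proj R n).

Lemma eq_torus_proj x y : proj x = proj y <-> exists z, x = y + mxR z.
Proof.
rewrite torus_projP; split=> -[z E]; exists z; first by rewrite -E addrC subrK.
by rewrite E addrC addKr.
Qed.

Lemma torus_projDz x z : proj (x + mxR z) = proj x.
Proof. by apply/eq_torus_proj; exists z. Qed.

Lemma torus_projD2r v x y : proj (x + v) = proj (y + v) <-> proj x = proj y.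
Proof. by rewrite !torus_projP opprD addrACA subrr addr0. Qed.

Definition fundamental_box : set 'cV[R]_n :=
  [set x | forall i, fundamental_interval R (x i 0)].

Definition torus_repr q : 'cV[R]_n :=
  let x := repr q : 'cV[R]_n in x - mxR (map_mx Num.floor x).

Lemma torus_reprK : cancel torus_repr proj.
Proof.
by move=> q; rewrite /torus_repr -map_mxN torus_projDz; exact: reprK.
Qed.

Lemma torus_repr_fundamental q : fundamental_box (torus_repr q).
Proof.
move=> i; rewrite /fundamental_interval /= !mxE.
by have := floor_itv ((repr q : 'cV[R]_n) i 0); rewrite intrD; lra.
Qed.

Lemma torus_proj_inj x y :
  fundamental_box x -> fundamental_box y -> proj x = proj y -> x = y.
Proof.
move=> x01 y01 /eq_torus_proj[z xE]; rewrite xE (_ : z = 0) ?map_mx0 ?addr0 //.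
apply/colP => i; move: (x01 i) (y01 i);
  rewrite xE /fundamental_interval /= !mxE.
move=> /andP[x0 x1] /andP[y0 y1].
have z1 : (z i 0)%:~R < 1%:~R :> R by lra.
have z2 : (-1)%:~R < (z i 0)%:~R :> R by rewrite rmorphN /=; lra.
by move: z1 z2; rewrite !ltr_int; lia.
Qed.

Lemma torus_projK x : fundamental_box x -> torus_repr (proj x) = x.
Proof.
by move=> x01; apply: torus_proj_inj (torus_repr_fundamental _) x01 _;
  rewrite torus_reprK.
Qed.

End TorusProjection.

Lemma fundamental_box_cvcons (R : realType) n t (x : 'cV[R]_n) :
  fundamental_box (cvcons t x) <->
    fundamental_interval R t /\ fundamental_box x.
Proof.
split=> [b|[t01 b] i].
  split=> [|i]; first by rewrite -(cvcons0 t x).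
  by rewrite -(cvcons_lift t).
by case: (unliftP 0 i) => [j|] ->; rewrite ?cvcons_lift ?cvcons0.
Qed.

Section TorusEuler.
Context {R : realType}.

Fixpoint torus_euler n : ('cV[R]_n -> int) -> int -> Prop :=
  match n with
  | 0 => fun f e => e = f 0
  | n'.+1 => fun f e => exists2 g : R -> int,
      {in fundamental_interval R, forall t,
        torus_euler (f \o @cvcons R n' t) (g t)} &
      circle_euler g e
  end.

Lemma eq_torus_euler n (f f' : 'cV[R]_n -> int) e :
  {in fundamental_box, f =1 f'} -> torus_euler f e -> torus_euler f' e.
Proof.
elim: n f f' e => [|n IH] f f' e ff' /=.
  by move=> ->; apply: ff'; rewrite inE => -[].
move=> [g fg ge]; exists g => // t t01; apply: IH (fg t t01) => x.
rewrite !inE in t01 * => x01; apply: ff'; rewrite inE.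
exact/fundamental_box_cvcons.
Qed.

Lemma torus_euler_unique n (f : 'cV[R]_n -> int) e e' :
  torus_euler f e -> torus_euler f e' -> e = e'.
Proof.
elim: n f e e' => [|n IH] f e e' /=; first by move=> -> ->.
move=> [g fg ge] [g' fg' ge']; apply: circle_euler_unique ge'.
by apply: eq_circle_euler ge => t t01; apply: IH (fg t t01) (fg' t t01).
Qed.

Lemma torus_eulerD n (f f' : 'cV[R]_n -> int) e e' :
  torus_euler f e -> torus_euler f' e' -> torus_euler (f \+ f') (e + e').
Proof.
elim: n f f' e e' => [|n IH] f f' e e' /=; first by move=> -> ->.
move=> [g fg ge] [g' fg' ge']; exists (g \+ g'); last exact: circle_eulerD.
by move=> t t01; apply: IH; [exact: fg|exact: fg'].
Qed.

Lemma torus_eulerM n c (f : 'cV[R]_n -> int) e :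
  torus_euler f e -> torus_euler (fun x => c * f x) (c * e).
Proof.
elim: n f e => [|n IH] f e /=; first by move=> ->.
move=> [g fg ge]; exists (fun t => c * g t); last exact: circle_eulerM.
by move=> t t01; apply: IH; exact: fg.
Qed.

Lemma torus_euler0 n : torus_euler (fun _ : 'cV[R]_n => 0) 0.
Proof.
by elim: n => [//|n IH] /=; exists (fun=> 0) => //; exact: circle_euler_cst.
Qed.

Lemma torus_euler_fsum (I : choiceType) n (D : set I)
    (f : I -> 'cV[R]_n -> int) e :
  finite_set D -> (forall i, D i -> torus_euler (f i) (e i)) ->
  torus_euler (fun x => \sum_(i \in D) f i x) (\sum_(i \in D) e i).
Proof.
move=> finD fD; rewrite fsbig_finite //.
rewrite (_ : (fun x => _) = \sum_(i <- fset_set D) f i); last first.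
  by rewrite fct_sumE; apply/funext => x; rewrite fsbig_finite.
rewrite !big_seq; apply: (big_ind2 (@torus_euler n)).
- exact: torus_euler0.
- by move=> f1 e1 f2 e2; exact: torus_eulerD.
- by move=> i; rewrite in_fset_set // inE; exact: fD.
Qed.

Lemma torus_euler_point n (p : 'cV[R]_n) :
  fundamental_box p -> torus_euler \chi_[set p] 1.
Proof.
elim: n p => [|n IH] p p01 /=; first by rewrite (flatmx0 p) indic_mem.
move: p01; rewrite -(cvcons_eta p) => /fundamental_box_cvcons[p0 p01].
exists \chi_[set p 0 0]; last exact: circle_euler_point.
move=> t _; have [->|tp] := eqVneq t (p 0 0).
  rewrite indic_mem //; apply: eq_torus_euler (IH _ p01) => x _ /=.
  by apply: eq_indic; split=> /= [->//|E]; have [] := cvcons_inj E.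
rewrite indic_memN; last by move=> /= E; rewrite E eqxx in tp.
apply: eq_torus_euler (torus_euler0 n) => x _ /=.
rewrite indic_memN // => E.
by have [/eqP] := cvcons_inj E; rewrite (negPf tp).
Qed.

Definition euler_char n (C : set (torus R n)) (e : int) : Prop :=
  torus_euler (\chi_C \o @torus_proj R n) e.

Lemma torus_euler_finite_translate n (V : set (torus R n)) (v : 'cV[R]_n) :
  finite_set V ->
  torus_euler (fun x => \chi_V (torus_proj (x + v))) (\sum_(q \in V) (1 : int)).
Proof.
move=> finV.
have := torus_euler_fsum finV (fun q _ =>
  torus_euler_point (torus_repr_fundamental (torus_proj (torus_repr q - v)))).
apply: eq_torus_euler => x; rewrite inE => x01 /=.
rewrite -[RHS]fsum_indic_set1; apply: eq_fsbigr => q _.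
apply: eq_indic; split=> /= [->|<-].
  rewrite -[RHS]torus_reprK -[in RHS](subrK v (torus_repr q)).
  by apply/torus_projD2r; rewrite torus_reprK.
rewrite -[LHS]torus_projK //; congr torus_repr; apply/(torus_projD2r v).
by rewrite subrK torus_reprK.
Qed.

Lemma euler_char_set1 n (q : torus R n) : euler_char [set q] 1.
Proof.
have := torus_euler_finite_translate 0 (finite_set1 q); rewrite fsbig_set1.
by apply: eq_torus_euler => x _; rewrite addr0.
Qed.

Lemma euler_char_fsum n (I : choiceType) (D : set I) (A : set (torus R n))
    (C : I -> set (torus R n)) (c e : I -> int) :
  finite_set D -> (forall q, \chi_A q = \sum_(i \in D) c i * \chi_(C i) q) ->
  (forall i, D i -> euler_char (C i) (e i)) ->
  euler_char A (\sum_(i \in D) c i * e i).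
Proof.
move=> finD AE CD; rewrite /euler_char.
rewrite (_ : _ \o _ = fun x => \sum_(i \in D) c i * \chi_(C i) (torus_proj x)).
  by apply: torus_euler_fsum => // i Di; apply: torus_eulerM; exact: CD.
by apply/funext => x; exact: AE.
Qed.

End TorusEuler.

(** * Projections of convex sets *)

Section Slices.
Context {R : realType} {n : nat}.
Implicit Types (U : set 'cV[R]_n.+1) (t : R).

Definition slice U t : set 'cV[R]_n := cvcons t @^-1` U.

Definition shadow U : set R := [set t | slice U t !=set0].

Lemma shadow_nonempty U : U !=set0 -> shadow U !=set0.
Proof.
by move=> [x Ux]; exists (x 0 0), (row' 0 x); rewrite /slice /= cvcons_eta.
Qed.

Lemma slice_convex U t : convex_set U -> convex_set (slice U t).
Proof.
move=> /convex_setP cU; apply/convex_setP => x y s Ux Uy s01.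
by have := cU _ _ s Ux Uy s01;
  rewrite !scale_cvcons cvconsD -mulrDl subrKC mul1r.
Qed.

Lemma slice_open U t : open U -> open (slice U t).
Proof. by move=> oU; apply: open_comp oU => x _; exact: cvcons_continuousr. Qed.

Lemma shadowE U : shadow U = (fun x : 'cV[R]_n.+1 => x 0 0) @` U.
Proof.
apply/seteqP; split=> [t [x Ux]|_ [x Ux <-]].
  by exists (cvcons t x); rewrite ?cvcons0.
by exists (row' 0 x); rewrite /slice /= cvcons_eta.
Qed.

Lemma shadow_interval U : convex_set U -> is_interval (shadow U).
Proof.
move=> /convex_connected cU; apply/connected_intervalP; rewrite shadowE.
apply: connected_continuous_connected cU _; apply: continuous_subspaceT.
exact: coord_continuous.
Qed.

Lemma shadow_open U : open U -> open (shadow U).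
Proof.
move=> oU; rewrite (_ : shadow U = \bigcup_x ((fun t => cvcons t x) @^-1` U));
  last first.
  by apply/seteqP; split=> [t [x Ux]|t [x _ Ux]]; exists x.
apply: bigcup_open => x _; apply: open_comp oU => t _.
exact: cvcons_continuousl.
Qed.

End Slices.

Section ConvexProjection.
Context {R : realType}.

Lemma eq_torus_proj_cvcons n (t s : R) (x y : 'cV[R]_n) :
  torus_proj (cvcons t x) = torus_proj (cvcons s y) <->
  (exists z : int, t = s + z%:~R) /\ torus_proj x = torus_proj y.
Proof.
split=> [/eq_torus_proj[z]|[[z ->] /eq_torus_proj[w ->]]].
  rewrite -(cvcons_eta z) map_cvcons cvconsD => E; have [-> ->] := cvcons_inj E.
  by rewrite torus_projDz; split=> //; exists (z 0 0).
by rewrite -cvconsD -(map_cvcons intr z w) torus_projDz.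
Qed.

Lemma slice_torus_inj n (U : set 'cV[R]_n.+1) t :
  set_inj U (@torus_proj R n.+1) -> set_inj (slice U t) (@torus_proj R n).
Proof.
move=> injU x y; rewrite !inE => Ux Uy xy.
have E : cvcons t x = cvcons t y.
  apply: injU; rewrite ?inE //; apply/eq_torus_proj_cvcons; split=> //.
  by exists 0; rewrite addr0.
by have [] := cvcons_inj E.
Qed.

Lemma indic_proj_slices n (U : set 'cV[R]_n.+1) (W : set int) t (y : 'cV[R]_n) :
  set_inj U (@torus_proj R n.+1) -> (forall z, shadow U (t + z%:~R) -> W z) ->
  \chi_(@torus_proj R n.+1 @` U) (torus_proj (cvcons t y)) =
    \sum_(z \in W)
      \chi_(@torus_proj R n @` slice U (t + z%:~R)) (torus_proj y).
Proof.
move=> injU UW; rewrite fsum_indic_trivIset; last first.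
  move=> z w _ _ [_ [[x1 Ux1 <-] [x2 Ux2 /esym x12]]].
  have E : cvcons (t + z%:~R) x1 = cvcons (t + w%:~R) x2.
    apply: injU; rewrite ?inE //; apply/eq_torus_proj_cvcons; split=> //.
    by exists (z - w); rewrite intrB -addrA subrKC.
  by have [/addrI/intr_inj] := cvcons_inj E.
apply: eq_indic; split=> /=.
  move=> [x Ux]; rewrite -(cvcons_eta x) => /eq_torus_proj_cvcons[[z x0] xy].
  have Uz : slice U (t + z%:~R) (row' 0 x) by rewrite /slice /= -x0 cvcons_eta.
  by exists z; [apply: UW; exists (row' 0 x)|exists (row' 0 x)].
move=> [z _ [x Ux xy]]; exists (cvcons (t + z%:~R) x) => //.
by apply/eq_torus_proj_cvcons; split=> //; exists z.
Qed.

Lemma fsum_fundamental_interval_translates (W : set int) (a : R) :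
  W (Num.floor a) ->
  \sum_(z \in W) \chi_(fundamental_interval R) (a - z%:~R) = 1.
Proof.
move=> Wa; transitivity (\chi_W (Num.floor a)); last by rewrite indic_mem.
rewrite -fsum_indic_set1; apply: eq_fsbigr => z _.
apply: eq_indic; rewrite /fundamental_interval; split=> /= [az|<-].
  by apply: floor_def; rewrite intrD; lra.
by have := floor_itv a; rewrite intrD; lra.
Qed.

Lemma circle_euler_itv_translates (W : set int) (a b : R) :
  a < b -> finite_set W -> W (Num.floor a) ->
  circle_euler (fun t => \sum_(z \in W) \chi_`]a, b[%classic (t + z%:~R)) (-1).
Proof.
move=> ab finW Wa.
have -> : -1 = \sum_(z \in W) - \chi_(fundamental_interval R) (a - z%:~R).
  rewrite -(fsum_fundamental_interval_translates Wa) -mulN1r mulr_fsumr.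
  by apply: eq_fsbigr => z _; rewrite mulN1r.
apply: circle_euler_fsum => // z _.
rewrite (_ : (fun t => _) = \chi_`]a - z%:~R, b - z%:~R[%classic).
  by apply: circle_euler_itv; rewrite ltrD2r.
by apply/funext => t; rewrite !indicE !mem_setE !in_itv /= ltrBlDr ltrBrDr.
Qed.

Lemma euler_char_convex n (U : set 'cV[R]_n) (M : R) :
  convex_set U -> open U -> (forall x i, U x -> `|x i 0| <= M) ->
  set_inj U (@torus_proj R n) -> U !=set0 ->
  euler_char (@torus_proj R n @` U) ((-1) ^+ n).
Proof.
elim: n U => [|n IH] U cU oU bU injU U0.
  rewrite /euler_char /= expr0 indic_mem //; have [x Ux] := U0.
  by exists x => //; rewrite (flatmx0 x).
have bI t : shadow U t -> `|t| <= M.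
  by move=> [x Ux]; have := bU _ 0 Ux; rewrite cvcons0.
have [a [b [ab aM IE]]] := open_bounded_interval (shadow_open oU)
  (shadow_interval cU) (shadow_nonempty U0) bI.
pose W := [set z : int | `|z%:~R| <= M + 1].
have finW : finite_set W by exact: finite_int_norm_le.
have in_W t z : fundamental_interval R t -> `|t + z%:~R| <= M -> W z.
  by rewrite /W /= !ler_norml => /andP[]; lra.
pose g t := \sum_(z \in W) (-1) ^+ n * \chi_`]a, b[%classic (t + z%:~R).
exists g => [t|].
  rewrite inE => t01.
  apply: (@eq_torus_euler _ _ (fun x =>
      \sum_(z \in W)
        \chi_(@torus_proj R n @` slice U (t + z%:~R)) (torus_proj x))).
    by move=> x _; rewrite /= (@indic_proj_slices _ _ W) // => z /bI;
      exact: in_W.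
  apply: torus_euler_fsum => // z _; rewrite -IE indicE.
  have [Ut|Ut] := pselect (shadow U (t + z%:~R)).
    rewrite mem_set // mulr1; apply: IH => //.
    - exact: slice_convex.
    - exact: slice_open.
    - by move=> x i Ux; have := bU _ (lift 0 i) Ux; rewrite cvcons_lift.
    - exact: slice_torus_inj.
  rewrite memNset // mulr0; apply: eq_torus_euler (torus_euler0 n) => x _.
  by rewrite indic_memN // => -[y Uy _]; apply: Ut; exists y.
rewrite exprSr (_ : g = fun t => (-1) ^+ n *
    \sum_(z \in W) \chi_`]a, b[%classic (t + z%:~R)); last first.
  by apply/funext => t; rewrite mulr_fsumr.
apply: circle_eulerM; apply: circle_euler_itv_translates => //.
apply: (in_W (a - (Num.floor a)%:~R)); last by rewrite subrK.
by have := floor_itv a; rewrite /fundamental_interval /= intrD; lra.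
Qed.

End ConvexProjection.

(** * Subtori *)

Section LatticePreimages.
Context {R : realType} {p n : nat}.
Local Notation mxR := (map_mx (intr : int -> R)).

Lemma finite_floor_affine (A : 'M[R]_(p, n)) (b : 'cV[R]_p) :
  finite_set [set map_mx Num.floor (A *m x - b) | x in fundamental_box].
Proof.
pose B := \sum_i (`|b i 0| + \sum_j `|A i j|).
have le_B i : `|b i 0| + \sum_j `|A i j| <= B.
  rewrite /B (bigD1 i) //= lerDl; apply: sumr_ge0 => k _.
  by rewrite addr_ge0 // sumr_ge0.
apply: sub_finite_set (finite_cV p (finite_int_norm_le (B + 1))).
move=> _ [x x01 <-] i; rewrite /= !mxE.
have Ax : `|\sum_j A i j * x j 0| <= \sum_j `|A i j|.
  apply: le_trans (ler_norm_sum _ _ _) _; apply: ler_sum => j _.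
  by have /andP[x0 x1] := x01 j; rewrite normrM (ger0_norm x0) ler_piMr // ltW.
have := le_trans (lerD (lexx `|b i 0|) Ax) (le_B i).
move: (\sum_j _) (floor_itv (\sum_j A i j * x j 0 - b i 0)) => s.
rewrite intrD addrC => fl /(le_trans (ler_normB _ _)).
by rewrite !ler_norml; lra.
Qed.

Lemma finite_lattice_preimage (A : 'M[R]_(p, n)) (b : 'cV[R]_p) :
  row_full A ->
  finite_set [set x | fundamental_box x /\ exists k, A *m x = b + mxR k].
Proof.
move=> /row_fullP[G GA].
apply: sub_finite_set (finite_image (fun k => G *m (b + mxR k))
  (finite_floor_affine A b)) => x [x01 [k Ax]].
exists k; last by rewrite -Ax mulmxA GA mul1mx.
exists x => //; rewrite Ax addrC addKr.
by apply/matrixP => i j; rewrite !mxE intrKfloor.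
Qed.

End LatticePreimages.

Section Subtorus.
Context {R : realType} {p : nat}.
Local Notation mxR := (map_mx (intr : int -> R)).
Implicit Types (b : 'cV[R]_p) (K : set 'cV[R]_p).

Definition sub_lattice_coset b K : Prop :=
  forall y, K y -> exists k, y = b + mxR k.

Definition lattice_invariant n (a : 'M[int]_(p, n)) K : Prop :=
  forall y z, K y -> K (y + mxR (a *m z)).

Lemma finite_proj_lattice_preimage n (a : 'M[int]_(p, n)) b K :
  row_full (mxR a) -> sub_lattice_coset b K ->
  lattice_invariant a K ->
  finite_set (@torus_proj R n @` [set x | K (mxR a *m x)]).
Proof.
move=> fulla Kb Ka.
apply: sub_finite_set (finite_image (@torus_proj R n)
  (finite_lattice_preimage b fulla)) => _ [x Kx <-].
exists (torus_repr (torus_proj x)); last by rewrite torus_reprK.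
split; first exact: torus_repr_fundamental.
have /eq_torus_proj[z ->] := torus_reprK (torus_proj x).
by rewrite mulmxDr -map_mxM; apply: Kb; exact: Ka.
Qed.

Lemma indic_lattice_preimage n (a : 'M[int]_(p, n)) K (x : 'cV[R]_n) :
  lattice_invariant a K ->
  \chi_K (mxR a *m x) =
    \chi_(@torus_proj R n @` [set x | K (mxR a *m x)]) (torus_proj x).
Proof.
move=> Ka; apply: eq_indic; split=> [Kx|]; first by exists x.
move=> [y /= Ky /esym/eq_torus_proj[z ->]].
by rewrite mulmxDr -map_mxM; exact: Ka.
Qed.

(* The slices of a subtorus are either positive-dimensional or finite; in the
   second case they are translates of one another, so that the outer integrand
   is constant. *)
Lemma torus_euler_subtorus n (a : 'M[int]_(p, n)) b K :
  ~~ row_full (mxR a) -> sub_lattice_coset b K ->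
  lattice_invariant a K ->
  torus_euler (fun x : 'cV[R]_n => \chi_K (mxR a *m x)) 0.
Proof.
elim: n a b K => [|n IH] a b K nfull Kb Ka.
  by have /row_fullPn[x] := nfull; rewrite (flatmx0 x) eqxx.
pose Kt t := [set y | K (t *: mxR (col 0 a) + y)].
have KE t (y : 'cV_n) :
    \chi_K (mxR a *m cvcons t y) = \chi_(Kt t) (mxR (col' 0 a) *m y).
  by rewrite mulmx_cvcons -map_col -map_col'.
have Ktb t : sub_lattice_coset (b - t *: mxR (col 0 a)) (Kt t).
  by move=> y /Kb[k E]; exists k; rewrite addrAC -E addrC addKr.
have Kta t : lattice_invariant (col' 0 a) (Kt t).
  move=> y z /(Ka _ (cvcons 0 z)).
  by rewrite mulmx_cvcons scale0r add0r /Kt /= addrA.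
have [full'|nfull'] := boolP (row_full (mxR (col' 0 a))); last first.
  exists (fun=> 0) => [t _|]; last exact: circle_euler_cst.
  apply: eq_torus_euler (IH (col' 0 a) _ _ nfull' (Ktb t) (Kta t)) => x _.
  by rewrite /= KE.
have [q qE] : exists q, mxR (col 0 a) = mxR (col' 0 a) *m q.
  by rewrite map_col map_col'; apply: col_mem_image_col'; rewrite -?map_col'.
pose V := @torus_proj R n @` [set x | Kt 0 (mxR (col' 0 a) *m x)].
have finV : finite_set V by exact: finite_proj_lattice_preimage (Ktb 0) (Kta 0).
exists (fun=> \sum_(v \in V) (1 : int)) => [t _|]; last exact: circle_euler_cst.
apply: eq_torus_euler (torus_euler_finite_translate (t *: q) finV) => x _ /=.
rewrite KE -indic_lattice_preimage; last exact: Kta.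
by apply: eq_indic; rewrite mulmxDr -scalemxAr -qE addrC /Kt /= scale0r add0r.
Qed.

End Subtorus.

(** * Winding numbers *)

Section CenteredFrac.
Context {R : realType}.
Implicit Types x y : R.

Definition centered_frac y : R := y - (Num.floor (y + 2^-1))%:~R.

Lemma centered_fracE y : exists k : int, centered_frac y = y + k%:~R.
Proof. by exists (- Num.floor (y + 2^-1)); rewrite intrN. Qed.

Lemma centered_fracDz y (k : int) : centered_frac (y + k%:~R) = centered_frac y.
Proof.
rewrite /centered_frac [y + _ + 2^-1]addrAC floorDrz ?intr_int //.
by rewrite intrD intrKfloor opprD addrACA subrr addr0.
Qed.

Lemma centered_frac_id y : `|y| < 2^-1 -> centered_frac y = y.
Proof.
rewrite ltr_norml => y2; rewrite /centered_frac (_ : Num.floor _ = 0) ?subr0 //.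
by apply: floor_def; rewrite add0r; lra.
Qed.

Lemma centered_frac0 : centered_frac 0 = 0.
Proof. by rewrite centered_frac_id // normr0; lra. Qed.

Lemma norm_centered_frac_le_half y : `|centered_frac y| <= 2^-1.
Proof.
by have := floor_itv (y + 2^-1); rewrite /centered_frac intrD ler_norml; lra.
Qed.

Lemma norm_centered_frac_le y : `|centered_frac y| <= `|y|.
Proof.
have [/centered_frac_id ->//|] := ltP `|y| 2^-1.
by apply: le_trans; exact: norm_centered_frac_le_half.
Qed.

Lemma norm_centered_fracN y : `|centered_frac (- y)| = `|centered_frac y|.
Proof.
suff le_frac x : `|centered_frac (- x)| <= `|centered_frac x|.
  by apply/eqP; rewrite eq_le le_frac -{1}(opprK y) le_frac.
have [k ->] := centered_fracE x;
  rewrite -(centered_fracDz _ (- k)) intrN -opprD.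
by rewrite -(normrN (x + _)); exact: norm_centered_frac_le.
Qed.

Lemma norm_centered_fracD x y :
  `|centered_frac (x + y)| <= `|centered_frac x| + `|centered_frac y|.
Proof.
have [k ->] := centered_fracE x; have [l ->] := centered_fracE y.
rewrite -(centered_fracDz _ (k + l)) intrD addrACA.
by apply: le_trans (norm_centered_frac_le _) (ler_normD _ _).
Qed.

Lemma centered_fracD_small x y :
  `|centered_frac x| < 4^-1 -> `|centered_frac y| < 4^-1 ->
  centered_frac (x + y) = centered_frac x + centered_frac y.
Proof.
have [k ->] := centered_fracE x; have [l ->] := centered_fracE y => xk yl.
rewrite -(centered_fracDz _ (k + l)) intrD addrACA centered_frac_id //.
by apply: le_lt_trans (ler_normD _ _) _; lra.
Qed.

Lemma continuous_norm_centered_frac : continuous (fun y => `|centered_frac y|).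
Proof.
have lip x y : `|centered_frac x| - `|centered_frac y| <= `|x - y|.
  rewrite lerBlDl -{1}(subrKC y x); apply: le_trans (norm_centered_fracD _ _) _.
  by rewrite lerD2l norm_centered_frac_le.
move=> x; apply/cvgrPdist_le => e e0; near=> y.
apply: (@le_trans _ _ `|x - y|); last by near: y; exact: cvgr_dist_le.
rewrite ler_norml; apply/andP; split; last exact: lip.
by rewrite lerNl opprB (distrC x y); exact: lip.
Unshelve. all: by end_near. Qed.

End CenteredFrac.

Section ContinuityMod1.
Context {R : realType}.

Definition mod1_continuous (X : topologicalType) (f : X -> R) : Prop :=
  forall x e, 0 < e -> \forall y \near x, `|centered_frac (f y - f x)| < e.

Lemma mod1_continuous_comp (X Y : topologicalType) (g : X -> Y) (f : Y -> R) :
  continuous g -> mod1_continuous f -> mod1_continuous (f \o g).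
Proof. by move=> cg cf x e e0; exact: cg _ _ (cf _ _ e0). Qed.

Lemma mod1_unif_continuous (X : pseudoMetricType R) (K : set X) (f : X -> R) e :
  compact K -> mod1_continuous f -> 0 < e ->
  \forall d \near 0^'+, forall x y, K x -> ball x d y ->
    `|centered_frac (f y - f x)| < e.
Proof.
move=> /compact_near_coveringP covK cf e0.
pose close d x := forall y, ball x d y -> `|centered_frac (f y - f x)| < e.
suff /covK : forall x, K x -> \forall x' \near x & d \near 0^'+, close d x'.
  by apply: filterS => d Kd x y /Kd; exact.
move=> x _; have e2 : 0 < e / 2 by rewrite divr_gt0.
have /nbhs_ballP[r /= r0 fr] := cf x _ e2.
have r2 : 0 < r / 2 by rewrite divr_gt0.
exists (ball x (r / 2), [set d | d <= r / 2]) => /=.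
  by split; [exact: nbhsx_ballx|exact: nbhs_right_le].
move=> [x' d] /= [xx' dr] y x'y.
have fx' : `|centered_frac (f x' - f x)| < e / 2.
  by apply: fr; apply: le_ball xx'; lra.
have fy : `|centered_frac (f y - f x)| < e / 2.
  by apply: fr; apply: (ball_split xx'); exact: le_ball x'y.
rewrite -(subrKA (f x)); apply: le_lt_trans (norm_centered_fracD _ _) _.
by rewrite -(opprB (f x')) norm_centered_fracN [e]splitr ltrD.
Qed.

End ContinuityMod1.

Section Winding.
Context {R : realType}.
Implicit Types (N : nat) (p q : nat -> R).

(* For a closed polygon [p 0, ..., p N] in R/Z with sides shorter than 1/2. *)
Definition winding N p : R := \sum_(k < N) centered_frac (p k.+1 - p k).

Lemma winding_homotopy N p q :
  (forall k, (k < N)%N -> `|centered_frac (p k.+1 - p k)| < 4^-1) ->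
  (forall k, (k < N)%N -> `|centered_frac (q k.+1 - q k)| < 4^-1) ->
  (forall k, (k <= N)%N -> `|centered_frac (q k - p k)| < 4^-1) ->
  p 0%N = p N -> q 0%N = q N -> winding N p = winding N q.
Proof.
move=> p_small q_small pq_small p0N q0N; pose s k := centered_frac (q k - p k).
apply/esym/eqP; rewrite -subr_eq0 /winding -sumrB.
rewrite (eq_bigr (fun k : 'I_N => s k.+1 - s k)) => [|k _].
  rewrite -(big_mkord xpredT (fun k => s k.+1 - s k)) telescope_sumr //.
  by rewrite /s p0N q0N subrr.
have kN := ltn_ord k.
have square : s k + centered_frac (q k.+1 - q k) =
    centered_frac (p k.+1 - p k) + s k.+1.
  rewrite -!centered_fracD_small ?p_small ?q_small ?pq_small // 1?ltnW //.
  by congr centered_frac; ring.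
by lra.
Qed.

Lemma winding_cst N c : winding N (fun=> c) = 0.
Proof. by rewrite /winding big1 // => k _; rewrite subrr centered_frac0. Qed.

Lemma winding_linear N p (d : int) : (2 * `|d| < N)%N ->
  (forall k, exists l : int, p k = p 0%N + k%:R * (d%:~R / N%:R) + l%:~R) ->
  winding N p = d%:~R.
Proof.
move=> dN lin; have N0 : N%:R != 0 :> R by rewrite pnatr_eq0; lia.
rewrite /winding (eq_bigr (fun=> d%:~R / N%:R)) => [|k _].
  by rewrite sumr_const card_ord -[LHS]mulr_natr divfK.
have [l ->] := lin k.+1; have [l' ->] := lin k.
rewrite (_ : _ - _ = d%:~R / N%:R + (l - l')%:~R); last first.
  by rewrite intrB -natr1; ring.
rewrite centered_fracDz centered_frac_id // normrM normfV normr_nat.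
rewrite ltr_pdivrMr ?lt0r ?N0 //=.
have : 2 * `|d|%N%:R < N%:R :> R by rewrite -natrM ltr_nat.
by rewrite -intr_norm -abszE -pmulrn; lra.
Qed.

Definition grid (phi : R * R -> R) N (j k : nat) : R :=
  phi (j%:R / N%:R, k%:R / N%:R).

Lemma mod1_continuous_fine_grid (phi : R * R -> R) e :
  mod1_continuous phi -> 0 < e ->
  \forall N \near \oo, forall j k j' k', (j <= N.+1)%N -> (k <= N.+1)%N ->
    (j <= j' <= j.+1)%N -> (k <= k' <= k.+1)%N ->
    `|centered_frac (grid phi N.+1 j' k' - grid phi N.+1 j k)| < e.
Proof.
move=> cphi e0.
have cK : compact (`[0, 1]%classic `*` `[0, 1]%classic : set (R * R)).
  by apply: compact_setX; exact: segment_compact.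
have [d /= d0 fine] : exists2 d : R, 0 < d & forall x y : R * R,
    (`[0, 1]%classic `*` `[0, 1]%classic) x -> ball x d y ->
    `|centered_frac (phi y - phi x)| < e.
  near (0 : R)^'+ => d; exists d; first by near: d; exact: nbhs_right_gt.
  by near: d; exact: mod1_unif_continuous.
apply: filterS (near_infty_natSinv_lt (PosNum d0)) =>
  N /= Nd j k j' k' jN kN jj' kk'.
have in01 i : (i <= N.+1)%N -> `[0, 1]%classic (i%:R / N.+1%:R : R).
  by move=> iN; rewrite /= in_itv /= divr_ge0 //= ler_pdivrMr // mul1r ler_nat.
have step i i' : (i <= i' <= i.+1)%N ->
  ball (i%:R / N.+1%:R : R) d (i'%:R / N.+1%:R).
  move=> /andP[ii' i'S];
    rewrite /ball /= -mulrBl normrM normfV normr_nat distrC.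
  rewrite ger0_norm ?subr_ge0 ?ler_nat // -natrB //.
  by apply: le_lt_trans Nd; rewrite ler_piMl // -[leRHS]/(1%:R) ler_nat; lia.
by apply: fine; split; [exact: in01|exact: in01|exact: step|exact: step].
Unshelve. all: by end_near. Qed.

Lemma mod1_homotopy_degree0 (phi : R * R -> R) (d : int) :
  mod1_continuous phi -> (forall u, phi (u, 0) = phi (u, 1)) ->
  (forall t, phi (1, t) = phi (1, 0)) ->
  (forall t, exists k : int, phi (0, t) = phi (0, 0) + t * d%:~R + k%:~R) ->
  d = 0.
Proof.
move=> cphi closed cst lin; have e0 : 0 < 4^-1 :> R by rewrite invr_gt0.
have [N [fine dN]] := filter_ex (filterI (mod1_continuous_fine_grid cphi e0)
  (nbhs_infty_gt (2 * `|d|)%N)).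
pose p := grid phi N.+1.
have winding_p j : (j <= N.+1)%N -> winding N.+1 (p j) = winding N.+1 (p 0%N).
  elim: j => // j IH jN; rewrite -IH; last exact: ltnW.
  have closed_p i : p i 0%N = p i N.+1.
    by rewrite /p /grid mul0r divff // closed.
  by apply/esym/winding_homotopy => // k kN; apply: fine; lia.
have pN : p N.+1 = fun=> phi (1, 0).
  by apply/funext => k; rewrite /p /grid divff // cst.
have := winding_p _ (leqnn _); rewrite pN winding_cst => /esym.
rewrite (@winding_linear _ _ d) => [/eqP||k]; first by rewrite intr_eq0 => /eqP.
  by rewrite (ltn_trans dN).
have [l E] := lin (k%:R / N.+1%:R); exists l.
by rewrite /p /grid mul0r E mulrAC -mulrA.
Qed.

End Winding.

(** * Topology of the torus *)

Section TorusTopology.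
Context {R : realType} {n : nat}.
Local Notation mxR := (map_mx (intr : int -> R)).
Local Notation proj := (@torus_proj R n).

Lemma torus_proj_continuous : continuous proj.
Proof. exact: pi_continuous. Qed.

Lemma torus_openE (V : set (torus R n)) : open V = open (proj @^-1` V).
Proof. by []. Qed.

Lemma connected_torus_proj (U : set 'cV[R]_n) :
  convex_set U -> connected (proj @` U).
Proof.
move=> cU; apply: connected_continuous_connected; first exact: convex_connected.
by apply: continuous_subspaceT; exact: torus_proj_continuous.
Qed.

Lemma torus_connected : connected [set: torus R n].
Proof.
have <- : proj @` setT = setT.
  by apply/seteqP; split=> // q _; exists (torus_repr q) => //;
    exact: torus_reprK.
by apply: connected_torus_proj; apply/convex_setP.
Qed.

Lemma torus_repr_mod1_continuous (i : 'I_n) :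
  mod1_continuous (fun q : torus R n => torus_repr q i 0).
Proof.
move=> q e e0; pose c := torus_repr q i 0.
pose V : set (torus R n) :=
  [set r | `|centered_frac (torus_repr r i 0 - c)| < e].
apply: (@open_nbhs_nbhs _ q V); split;
  last by rewrite /V /= subrr centered_frac0 normr0.
rewrite torus_openE (_ : _ @^-1` V =
    (fun y : 'cV[R]_n => y i 0) @^-1` ((fun y => `|centered_frac (y - c)|) @^-1`
      [set t | t < e])).
  apply: open_comp => [y _|]; first exact: coord_continuous.
  apply: open_comp => [y _|]; last exact: open_lt.
  apply: (@continuous_comp _ _ _ (fun y => y - c)
    (fun y => `|centered_frac y|)).
    by apply: cvgB; [exact: cvg_id|exact: cvg_cst].
  exact: continuous_norm_centered_frac.
apply/funext => y; rewrite /V /=.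
have /eq_torus_proj[z ->] := torus_reprK (proj y).
by rewrite !mxE addrAC centered_fracDz.
Qed.

Lemma null_homotopic_line_loop_trivial (F : R * R -> torus R n) x
    (v : 'cV[int]_n) :
  continuous F -> (forall u, F (u, 0) = F (u, 1)) ->
  (forall t, F (1, t) = F (1, 0)) ->
  (forall t, F (0, t) = proj (x + t *: mxR v)) -> v = 0.
Proof.
move=> cF closed cst line; apply/colP => i; rewrite [RHS]mxE.
apply: (@mod1_homotopy_degree0 R (fun p => torus_repr (F p) i 0)).
- exact: mod1_continuous_comp cF (torus_repr_mod1_continuous i).
- by move=> u; rewrite closed.
- by move=> t; rewrite cst.
- move=> t; rewrite !line.
  have /eq_torus_proj[z ->] := torus_reprK (proj (x + t *: mxR v)).
  have /eq_torus_proj[w ->] := torus_reprK (proj (x + 0 *: mxR v)).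
  by exists (z i 0 - w i 0); rewrite !mxE mul0r intrB; ring.
Qed.

Lemma unit_ballZ (c : R) (x : 'cV[R]_n) :
  `|c| <= 1 -> unit_ball R n x -> unit_ball R n (c *: x).
Proof.
move=> c1; apply: le_lt_trans; apply: ler_sum => i _.
rewrite mxE exprMn ler_piMl ?sqr_ge0 // -real_normK ?num_real //.
by rewrite expr_le1.
Qed.

End TorusTopology.

(* The loop [s |-> x + s v] is contracted by transporting it to the ball and
   scaling it there by [cos (pi u / 2)], which is in [-1, 1] for all real
   [u]. *)
Lemma ball_line_loop_trivial (R : realType) p n (C : set (torus R n))
    (x : 'cV[R]_n) (v : 'cV[int]_n) :
  homeomorphic C (unit_ball R p) ->
  (forall t : R, C (torus_proj (x + t *: map_mx intr v))) -> v = 0.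
Proof.
move=> [f [g [fC _ fK _ [cf cg]]]] Cv.
pose line (t : R) : torus R n := torus_proj (x + t *: map_mx intr v).
pose loop := f \o line.
have loopB t : unit_ball R p (loop t).
  by apply: fC; exists (line t) => //; exact: Cv.
have cloop : continuous loop.
  apply: (continuous_within_comp _ Cv cf) => t.
  apply: continuous_comp; last exact: torus_proj_continuous.
  by apply: cvgD; [exact: cvg_cst|apply: cvgZr_tmp; exact: cvg_id].
pose h (u : R * R) := cos (pi / 2 * u.1) *: loop u.2.
have hB u : unit_ball R p (h u).
  by apply: unit_ballZ => //; rewrite ler_norml cos_geN1 cos_le1.
have ch : continuous h.
  move=> u; apply: cvgZ.
    apply: (@continuous_comp _ _ _ (fun u : R * R => pi / 2 * u.1) cos);
      last exact: continuous_cos.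
    by apply: cvgM; [exact: cvg_cst|exact: cvg_fst].
  apply: (@continuous_comp _ _ _ snd loop); [exact: cvg_snd|exact: cloop].
apply: (@null_homotopic_line_loop_trivial R n (g \o h) x).
- exact: continuous_within_comp cg.
- move=> u; rewrite /= /h /= (_ : loop 0 = loop 1) //; congr f.
  by apply/esym/eq_torus_proj; exists v; rewrite scale1r scale0r addr0.
- by move=> t; rewrite /= /h /= mulr1 cos_pihalf !scale0r.
- by move=> t; rewrite /= /h /= mulr0 cos0 scale1r /loop /= fK //; exact: Cv.
Qed.

(** * Cells and flats *)

Section Cells.
Context {R : realType} {p n : nat}.
Local Notation mxR := (map_mx (intr : int -> R)).
Variables (a : 'M[int]_(p, n)) (b : 'cV[R]_p).
Implicit Types k l : 'cV[int]_p.

Definition cell k : set 'cV[R]_n :=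
  [set x | forall i, (k i 0)%:~R < (mxR a *m x - b) i 0 < (k i 0 + 1)%:~R].

Definition flat k : set 'cV[R]_n := [set x | mxR a *m x = b + mxR k].

Lemma floor_cell k x : cell k x -> map_mx Num.floor (mxR a *m x - b) = k.
Proof.
move=> kx; apply/colP => i; rewrite mxE.
by apply: floor_def; have /andP[/ltW -> ->] := kx i.
Qed.

Lemma cell_inj k l x : cell k x -> cell l x -> k = l.
Proof. by move=> /floor_cell <- /floor_cell <-. Qed.

Lemma cell_floor x : (forall i, (mxR a *m x - b) i 0 \isn't a Num.int) ->
  cell (map_mx Num.floor (mxR a *m x - b)) x.
Proof.
move=> nint i; have := nint i; rewrite [map_mx _ _ _ _]mxE intrEfloor => ne.
by rewrite lt_neqAle ne floor_itv.
Qed.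

Lemma cell_notint k x i : cell k x -> (mxR a *m x - b) i 0 \isn't a Num.int.
Proof.
move=> kx; have /andP[/lt_eqF ne _] := kx i.
by rewrite intrEfloor -(floor_cell kx) mxE in ne *; rewrite ne.
Qed.

Lemma cell_open k : open (cell k).
Proof.
pose B (i : 'I_p) : set R := `](k i 0)%:~R, (k i 0 + 1)%:~R[%classic.
have -> : cell k =
    (fun x => mxR a *m x - b) @^-1` [set y | forall i, B i (y i 0)].
  by apply/seteqP; split=> x kx i; have := kx i; rewrite /B /= in_itv.
apply: open_comp => [x _|]; last by apply: open_box => i; exact: interval_open.
by apply: continuousB; [exact: mulmx_continuous|exact: cst_continuous].
Qed.

Lemma cell_convex k : convex_set (cell k).
Proof.
apply/convex_setP => x y s kx ky s01 i.
rewrite [X in _ < X < _](_ : _ =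
    s * (mxR a *m x - b) i 0 + (1 - s) * (mxR a *m y - b) i 0).
  exact: convex_comb_itv.
rewrite mulmxDr -!scalemxAr; move: (mxR a *m x) (mxR a *m y) => X Y.
by rewrite !mxE; ring.
Qed.

Lemma cellDz k x z : cell k (x + mxR z) <-> cell (k - a *m z) x.
Proof.
rewrite /cell /= (_ : mxR a *m _ - b = mxR a *m x - b + mxR (a *m z)).
  move: (mxR a *m x - b) (a *m z) => X Z.
  by split=> kx i; have := kx i; rewrite !mxE !(intrD, intrN); lra.
by rewrite mulmxDr -map_mxM addrAC.
Qed.

Lemma flat_convex k : convex_set (flat k).
Proof.
apply/convex_setP => x y s kx ky _.
by rewrite /flat /= mulmxDr -!scalemxAr kx ky -scalerDl subrKC scale1r.
Qed.

Lemma flatDz k x z : flat k (x + mxR z) <-> flat (k - a *m z) x.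
Proof.
rewrite /flat /= mulmxDr -map_mxM map_mxB addrA.
by split=> [<-|->]; rewrite ?addrK ?subrK.
Qed.

Lemma row_full_cell_bounded k : row_full (mxR a) ->
  exists M, forall x i, cell k x -> `|x i 0| <= M.
Proof.
move=> /row_fullP[G GA]; pose c i := `|b i 0| + `|(k i 0)%:~R| + 1 : R.
exists (\sum_j \sum_i `|G j i| * c i) => x j kx.
rewrite -[x]mul1mx -GA -mulmxA mxE (bigD1 j) //= -[leLHS]addr0.
apply: lerD; last first.
  apply: sumr_ge0 => l _; apply: sumr_ge0 => i _.
  by rewrite mulr_ge0 // !addr_ge0.
apply: le_trans (ler_norm_sum _ _ _) _; apply: ler_sum => i _.
rewrite normrM ler_wpM2l // /c; have := kx i.
rewrite [(_ - b) i 0]mxE [(- b) i 0]mxE intrD.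
have := ler_norm (b i 0); have := ler_norm (- b i 0).
have := ler_norm (- (k i 0)%:~R : R); have := ler_norm ((k i 0)%:~R : R).
by rewrite !normrN ler_norml; move: ((mxR a *m x) i 0) => y; lra.
Qed.

End Cells.

(* Cells and flats are both families of convex pieces lying in disjoint open
   cells, which separate the projections of the pieces from one another. *)
Section PieceComponents.
Context {R : realType} {p n : nat}.
Local Notation mxR := (map_mx (intr : int -> R)).
Local Notation proj := (@torus_proj R n).
Variables (a : 'M[int]_(p, n)) (b : 'cV[R]_p).

Definition translation_equivariant (L : 'cV[int]_p -> set 'cV[R]_n) : Prop :=
  forall k x z, L k (x + mxR z) <-> L (k - a *m z) x.

Lemma image_torus_projP L k x : translation_equivariant L ->
  (proj @` L k) (proj x) <-> exists z, L (k + a *m z) x.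
Proof.
move=> LDz; split=> [[y ky /eq_torus_proj[z E]]|[z kz]].
  by exists (- z); move: ky; rewrite E => /LDz; rewrite mulmxN.
exists (x - mxR z); last by rewrite -map_mxN torus_projDz.
by rewrite -map_mxN; apply/LDz; rewrite mulmxN opprK.
Qed.

Lemma open_torus_cell k : open (proj @` cell a b k).
Proof.
rewrite torus_openE (_ : _ @^-1` _ = \bigcup_z cell a b (k + a *m z)).
  by apply: bigcup_open => z _; exact: cell_open.
apply/seteqP; split=> x /=.
  by move=> /(image_torus_projP _ _ (@cellDz _ _ _ a b))[z kz]; exists z.
by move=> [z _ kz]; apply/(image_torus_projP _ _ (@cellDz _ _ _ a b)); exists z.
Qed.

Variable L : 'cV[int]_p -> set 'cV[R]_n.
Hypothesis L_cell : forall k, L k `<=` cell a b k.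
Hypothesis L_convex : forall k, convex_set (L k).
Hypothesis L_Dz : translation_equivariant L.

Lemma piece_component k x : L k x ->
  connected_component (proj @` \bigcup_k L k) (proj x) = proj @` L k.
Proof.
move=> kx; pose orbit := [set l | exists z, l = k + a *m z].
have cellP l y := image_torus_projP l y (@cellDz _ _ _ a b).
apply: (@connected_component_open_partition _ _ _ (proj @` cell a b k)
  (\bigcup_(l in ~` orbit) proj @` cell a b l)).
- exact: connected_torus_proj.
- by exists x.
- exact: open_torus_cell.
- by apply: bigcup_open => l _; exact: open_torus_cell.
- apply/seteqP; split=> [_ [[y [l _ ly] <-] /cellP[z kz]]|_ [y ky <-]].
    apply/(image_torus_projP _ _ L_Dz); exists z.
    by rewrite -(cell_inj (L_cell ly) kz).
  by split; exists y => //; [exists k|exact: L_cell].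
- apply/seteqP; split=> [_ [[y [l _ ly] <-] [l' nl' /cellP[z l'z]]]|].
    split=> [|/(image_torus_projP _ _ L_Dz)[w kw]].
      by exists y => //; exists l.
    apply: nl'; exists (w - z); rewrite mulmxBr addrA.
    by rewrite (cell_inj (L_cell kw) l'z) addrK.
  move=> _ [[y [l _ ly] <-] nky]; split; first by exists y => //; exists l.
  exists l; last by exists y => //; exact: L_cell.
  move=> [z lE]; apply: nky; apply/(image_torus_projP _ _ L_Dz).
  by exists z; rewrite -lE.
Qed.

Lemma piece_componentsP C : components (proj @` \bigcup_k L k) C ->
  exists k x, [/\ fundamental_box x, L k x & C = proj @` L k].
Proof.
move=> [_ [y [l _ ly] <-] <-].
have /eq_torus_proj[z xE] := torus_reprK (proj y).
exists (l + a *m z), (torus_repr (proj y)).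
have Lx : L (l + a *m z) (torus_repr (proj y)).
  by rewrite xE; apply/L_Dz; rewrite addrK.
split=> //; first exact: torus_repr_fundamental.
by rewrite -(piece_component Lx) torus_reprK.
Qed.

Lemma piece_components_finite : finite_set (components (proj @` \bigcup_k L k)).
Proof.
have fin := finite_image (fun k => proj @` L k) (finite_floor_affine (mxR a) b).
apply: sub_finite_set fin => C /piece_componentsP[k [x [x01 kx ->]]].
by exists k => //; exists x => //; exact/floor_cell/L_cell.
Qed.

End PieceComponents.

Section Components.
Context {R : realType} {p n : nat}.
Local Notation proj := (@torus_proj R n).
Variables (a : 'M[int]_(p, n)) (b : 'cV[R]_p).

Lemma cell_componentsP C : components (proj @` \bigcup_k cell a b k) C ->
  exists2 k, cell a b k !=set0 & C = proj @` cell a b k.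
Proof.
have subid k : cell a b k `<=` cell a b k by [].
move=> /(piece_componentsP subid (@cell_convex _ _ _ a b) (@cellDz _ _ _ a b)).
by move=> [k [x [_ kx ->]]]; exists k => //; exists x.
Qed.

Lemma cell_components_finite :
  finite_set (components (proj @` \bigcup_k cell a b k)).
Proof.
by apply: (@piece_components_finite _ _ _ a b (cell a b));
  [move=> k|exact: cell_convex|exact: cellDz].
Qed.

(* Shifting the offset by 1/2 puts every flat in the interior of a cell. *)
Lemma flat_sub_cell k : flat a b k `<=` cell a (b - const_mx 2^-1) k.
Proof.
by move=> x kx i; rewrite kx !mxE intrD; lra.
Qed.

Lemma flat_componentsP C : components (proj @` \bigcup_k flat a b k) C ->
  exists2 k, flat a b k !=set0 & C = proj @` flat a b k.
Proof.
move=> /(piece_componentsP flat_sub_cell (@flat_convex _ _ _ a b)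
  (@flatDz _ _ _ a b)).
by move=> [k [x [_ kx ->]]]; exists k => //; exists x.
Qed.

Lemma flat_components_finite :
  finite_set (components (proj @` \bigcup_k flat a b k)).
Proof.
apply: (piece_components_finite flat_sub_cell); first exact: flat_convex.
exact: flatDz.
Qed.

End Components.

(** * Toric hyperplanes and subspaces *)

Section ToricHyperplanes.
Context {R : realType} {n : nat}.
Local Notation mxR := (map_mx (intr : int -> R)).
Local Notation proj := (@torus_proj R n).

Lemma toric_hyperplane_form (V : set (torus R n)) : toric_hyperplane V ->
  exists (r : 'rV[int]_n) (b : R),
    (exists z : 'cV[int]_n, r *m z = 1%:M) /\
    forall x, V (proj x) <-> (mxR r *m x) 0 0 - b \is a Num.int.
Proof.
move=> [u [b [u0 ->]]]; have [c [r [z [c0 ucr rz]]]] := rat_cV_primitive u0.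
have c0R : ratr c != 0 :> R by rewrite fmorph_eq0.
have formE (x : 'cV[R]_n) :
    \sum_(i < n) ratr (u i 0) * x i 0 = ratr c * (mxR r *m x) 0 0.
  rewrite mxE mulr_sumr; apply: eq_bigr => i _; rewrite mulrA; congr (_ * _).
  by have /rowP/(_ i) := ucr; rewrite !mxE => ->; rewrite rmorphM /= ratr_int.
have formDz x w :
    (mxR r *m (x + mxR w)) 0 0 = (mxR r *m x) 0 0 + ((r *m w) 0 0)%:~R.
  by rewrite mulmxDr -map_mxM !mxE.
exists r, (b / ratr c); split; first by exists z.
move=> x; split=> [[y /= yb /esym/eq_torus_proj[w ->]]|/intrP[k kE]].
  rewrite formDz -yb formE mulrAC divff // mul1r addrAC subrr add0r.
  exact: intr_int.
exists (x - mxR (k *: z)); last by rewrite -map_mxN torus_projDz.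
have rkz : (r *m - (k *: z)) 0 0 = - k.
  by rewrite mulmxN -scalemxAr rz !mxE mulr1.
by rewrite /= formE -map_mxN formDz rkz intrN -kE; field.
Qed.

Lemma toric_hyperplane_neqT (V : set (torus R n)) :
  toric_hyperplane V -> V <> setT.
Proof.
move=> /toric_hyperplane_form[r [b [[z rz] VE]]] VT.
have : V (proj ((b + 2^-1) *: mxR z)) by rewrite VT.
rewrite VE -scalemxAr -map_mxM rz !mxE mulr1 addrAC subrr add0r.
by move=> /intrP[k /esym/intr_neq_half].
Qed.

End ToricHyperplanes.

Section ToricSubspaces.
Context {R : realType} {n : nat}.
Local Notation mxR := (map_mx (intr : int -> R)).
Local Notation proj := (@torus_proj R n).

Lemma toric_subspace_dim0 k (V : set (torus R n)) :
  toric_subspace k V -> k = 0%N <-> exists q, V = [set q].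
Proof.
move=> [p [A [c [[x /= xc] -> ->]]]].
have -> : (n - \rank A = 0)%N <-> row_full (map_mx (@ratr R) A).
  rewrite /row_full mxrank_map eqn_leq rank_leq_col.
  by split=> [/eqP|nr]; rewrite -?subn_eq0 //; apply/eqP; rewrite subn_eq0.
split=> [fullA|[q Vq]].
  exists (proj x); apply/seteqP; split=> [_ [y /= yc <-]|_ ->];
    last by exists x.
  by congr proj; apply: (row_full_inj fullA); rewrite xc yc.
apply: contraT => /row_fullPn[v v0 Av].
have line_q (s : R) : proj (x + s *: v) = q.
  rewrite -[_ = q]/([set q] _) -Vq; exists (x + s *: v) => //=.
  by rewrite mulmxDr -scalemxAr Av scaler0 addr0.
have /matrix0Pn[i [j]] := v0; rewrite (ord1 j) => vi.
have /eq_torus_proj[z] : proj (x + (2 * v i 0)^-1 *: v) = proj (x + 0 *: v).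
  by rewrite !line_q.
move=> /colP/(_ i); rewrite !mxE mul0r addr0 => /addrI.
by rewrite invfM mulfVK // => /esym/intr_neq_half.
Qed.

Lemma toric_dim_eq0 k (V : set (torus R n)) :
  toric_subspace k V -> toric_dim V = 0%N <-> exists q, V = [set q].
Proof.
move=> Vk; rewrite /toric_dim; case: xgetP => [l _ /= Vl|/(_ k)//].
exact: toric_subspace_dim0 Vl.
Qed.

Lemma toric_subspace_flat p (a : 'M[int]_(p, n)) (b : 'cV[R]_p) k :
  flat a b k !=set0 ->
  toric_subspace (n - \rank (map_mx intr a : 'M[rat]_(p, n)))
    (proj @` flat a b k).
Proof.
move=> [x kx]; exists p, (map_mx intr a), (b + mxR k).
rewrite (_ : map_mx ratr (map_mx intr a) = mxR a).
  by split=> //; exists x.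
by apply/matrixP => i j; rewrite !mxE ratr_int.
Qed.

Lemma euler_char_flat p (a : 'M[int]_(p, n)) (b : 'cV[R]_p) k :
  let C := proj @` flat a b k in
  flat a b k !=set0 ->
  euler_char C (toric_dim C == 0%N)%:Z.
Proof.
move=> C k0; have CT := toric_subspace_flat k0; have dimC := toric_dim_eq0 CT.
have [fulla|nfull] := boolP (row_full (mxR a)).
  have [q Cq] : exists q, C = [set q].
    apply/(toric_subspace_dim0 CT)/eqP.
    by rewrite subn_eq0 -(@mxrank_intr R) (eqP fulla).
  by rewrite (dimC.2 _) ?Cq; [exact: euler_char_set1|exists q].
have -> : (toric_dim C == 0%N) = false.
  apply: contraNF nfull => /eqP/dimC/(toric_subspace_dim0 CT)/eqP.
  by rewrite subn_eq0 /row_full eqn_leq rank_leq_col mxrank_intr.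
pose K := [set y | exists z, y = b + mxR (k + a *m z)].
have CE (x : 'cV[R]_n) : \chi_K (mxR a *m x) = \chi_C (torus_proj x).
  by apply: eq_indic; rewrite /C (image_torus_projP _ _ (@flatDz _ _ _ a b)).
apply: (eq_torus_euler (fun x _ => CE x)).
apply: (torus_euler_subtorus (b := b) nfull) => [y [z ->]|y w [z ->]].
  by exists (k + a *m z).
by exists (z + w); rewrite -addrA -map_mxD mulmxDr addrA.
Qed.

Lemma euler_char_cell p (a : 'M[int]_(p, n)) (b : 'cV[R]_p) k :
  row_full (mxR a) -> cell a b k !=set0 ->
  euler_char (proj @` cell a b k) ((-1) ^+ n).
Proof.
move=> fulla k0; have [M kM] := row_full_cell_bounded b k fulla.
apply: (@euler_char_convex R n (cell a b k) M) => //.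
- exact: cell_convex.
- exact: cell_open.
move=> x y; rewrite !inE => kx ky /eq_torus_proj[z xE].
move: kx; rewrite xE => /cellDz kx.
have az : a *m z = 0.
  by apply/oppr_inj/(addrI k); rewrite (cell_inj kx ky) oppr0 addr0.
have /(row_full_inj fulla) : mxR a *m mxR z = mxR a *m 0.
  by rewrite -map_mxM az map_mx0 mulmx0.
by move=> ->; rewrite addr0.
Qed.

End ToricSubspaces.

(** * Toric arrangements *)

Section Strata.
Context {R : realType} {n m : nat} (H : 'I_m -> set (torus R n)).
Local Notation P := (intersection_poset H).
Local Notation mu := (mobius P (@rev_incl R n) setT).

Definition stratum (q : torus R n) : set (torus R n) :=
  connected_component (\bigcap_(i in [set i | H i q]) H i) q.

Lemma stratum_refl q : stratum q q.
Proof. by apply: connected_component_refl => i. Qed.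

Lemma stratum_in_poset q : P (stratum q).
Proof.
right; exists [set i | `[< H i q >]]%SET, q.
  by move=> i; rewrite /= inE => /asboolP.
congr connected_component; apply: eq_bigcapl.
by split=> i; rewrite /= inE => /asboolP.
Qed.

Lemma stratum_sub C q : P C -> C q -> stratum q `<=` C.
Proof.
move=> [->//|[S [r Sr <-]]] rq; rewrite (same_connected_component rq).
apply: connected_component_max; first exact: stratum_refl.
  move=> s /connected_component_sub sH i /= iS; apply: sH => /=.
  exact: (connected_component_sub rq).
exact: component_connected.
Qed.

Hypothesis H_neqT : forall i, H i <> setT.

Lemma stratum_eqT q : stratum q = setT <-> (~` \bigcup_i H i) q.
Proof.
split=> [qT [i _ Hiq]|nHq].
  apply: (H_neqT (i := i)); rewrite -subTset -qT.
  by move=> r /connected_component_sub; exact.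
apply/seteqP; split=> //; apply: connected_component_max => //.
  by move=> r _ i Hiq; case: nHq; exists i.
exact: torus_connected.
Qed.

Lemma indic_complement_strata q : finite_set P ->
  \chi_(~` \bigcup_i H i) q = \sum_(C \in P `\ set0) mu C * \chi_C q.
Proof.
move=> finP; have -> : \chi_(~` \bigcup_i H i) q = (setT == stratum q)%:Z.
  have [qT|nqT] := eqVneq; first by rewrite indic_mem //; apply/stratum_eqT.
  by rewrite indic_memN // => /stratum_eqT qT; rewrite qT eqxx in nqT.
rewrite -(fsum_mobius (P := P) (le := @rev_incl R n) finP) //; first last.
- exact: stratum_in_poset.
- by move=> A B C BA CB; exact: subset_trans BA.
- by move=> A B BA AB; apply/seteqP.
- by move=> A; exact: subset_refl.
rewrite (eq_fsbigr (fun C => mu C * \chi_C q)) => [|C]; last first.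
  by rewrite inE => -[_ _ qC]; rewrite indic_mem ?mulr1 //;
    exact/qC/stratum_refl.
apply: fsbig_widen => [C [PC _ qC]|C [[PC _] nC] /=].
  by split=> // C0; have := qC _ (stratum_refl q); rewrite C0.
rewrite indic_memN ?mulr0 // => Cq; apply: nC.
by split=> //; exact: stratum_sub.
Qed.

Lemma toric_char_poly_at0 : finite_set P ->
  (toric_char_poly H).[0] =
    \sum_(C \in P `\ set0) mu C * (toric_dim C == 0%N)%:Z.
Proof.
move=> finP; have finP0 : finite_set (P `\ set0) by exact: finite_setD.
rewrite /toric_char_poly !fsbig_finite // horner_sum; apply: eq_bigr => C _.
by rewrite hornerZ hornerXn expr0n natz.
Qed.

End Strata.

Section Arrangement.
Context {R : realType} {n m : nat} (H : 'I_m -> set (torus R n)).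
Context (a : 'M[int]_(m, n)) (b : 'cV[R]_m).
Local Notation mxR := (map_mx (intr : int -> R)).
Local Notation proj := (@torus_proj R n).
Local Notation P := (intersection_poset H).
Hypothesis H_form :
  forall i x, H i (proj x) <-> (mxR a *m x - b) i 0 \is a Num.int.

Lemma bigcap_flats (S : {set 'I_m}) :
  let s : 'I_#|S| -> 'I_m := enum_val in
  \bigcap_(i in [set` S]) H i =
    proj @` \bigcup_k flat (rowsub s a) (rowsub s b) k.
Proof.
move=> s; have formE (x : 'cV[R]_n) j :
    (mxR (rowsub s a) *m x - rowsub s b) j 0 = (mxR a *m x - b) (s j) 0.
  by rewrite map_mxsub mul_rowsub_mx !mxE.
apply/seteqP; split=> [q Hq|_ [x [k _ kx] <-] i iS].
  pose x := torus_repr q; pose y := mxR (rowsub s a) *m x - rowsub s b.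
  exists x; last exact: torus_reprK.
  exists (map_mx Num.floor y) => //; rewrite /flat /= (_ : map_mx _ _ = y).
    by rewrite /y subrKC.
  apply/colP => j; rewrite 2!mxE floorK // formE; apply/H_form.
  by rewrite torus_reprK; apply: Hq; exact: enum_valP.
apply/H_form; rewrite -(enum_rankK_in iS iS) -formE kx addrC addKr.
by rewrite mxE intr_int.
Qed.

Lemma complement_cells : ~` (\bigcup_i H i) = proj @` \bigcup_k cell a b k.
Proof.
apply/seteqP; split=> [q nHq|_ [x [k _ kx] <-] [i _ /H_form]]; last first.
  by apply/negP; exact: cell_notint kx.
exists (torus_repr q); last exact: torus_reprK.
eexists; first by []; apply: cell_floor => i; apply/negP => /H_form Hi.
by apply: nHq; exists i => //; rewrite torus_reprK in Hi.
Qed.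

Lemma regionP C : regions H C ->
  exists2 k, cell a b k !=set0 & C = proj @` cell a b k.
Proof. by rewrite /regions complement_cells => /cell_componentsP. Qed.

Lemma regions_finite : finite_set (regions H).
Proof. by rewrite /regions complement_cells; exact: cell_components_finite. Qed.

Lemma intersection_poset_finite : finite_set P.
Proof.
have -> : P = [set set0] `|`
    \bigcup_(S in [set: {set 'I_m}]) components (\bigcap_(i in [set` S]) H i).
  apply/seteqP; split=> C [C0|];
    [by left|move=> [S SC]|by left|move=> [S _ SC]];
    by right; exists S.
rewrite finite_setU; split; first exact: finite_set1.
apply: bigcup_finite => [|S _]; first exact: finite_finset.
by rewrite bigcap_flats; exact: flat_components_finite.
Qed.

Lemma euler_char_stratum C : P C -> C <> set0 ->
  euler_char C (toric_dim C == 0%N)%:Z.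
Proof.
move=> [//|[S]]; rewrite bigcap_flats => /flat_componentsP[k k0 ->] _.
exact: euler_char_flat.
Qed.

Lemma euler_char_complement_strata : (forall i, H i <> setT) ->
  euler_char (~` \bigcup_i H i) (toric_char_poly H).[0].
Proof.
move=> H_neqT; have finP := intersection_poset_finite.
rewrite toric_char_poly_at0 //.
apply: (euler_char_fsum (C := id)) => [|q|C [PC C0]]; first exact: finite_setD.
  exact: indic_complement_strata.
exact: euler_char_stratum.
Qed.

Lemma region_ball_row_full C :
  regions H C -> homeomorphic C (unit_ball R n) -> row_full (mxR a).
Proof.
move=> /regionP[k [x kx] ->] ball; apply: contraT => /integral_kernel[v v0 av].
suff vE : v = 0 by rewrite vE eqxx in v0.
apply: (ball_line_loop_trivial (x := x) ball) => t.
exists (x + t *: mxR v) => // i.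
by rewrite mulmxDr -scalemxAr -map_mxM av map_mx0 scaler0 addr0; exact: kx.
Qed.

Lemma euler_char_region C : regions H C -> homeomorphic C (unit_ball R n) ->
  euler_char C ((-1) ^+ n).
Proof.
move=> regC /(region_ball_row_full regC) fulla; have [k k0 ->] := regionP regC.
exact: euler_char_cell.
Qed.

Lemma euler_char_complement_regions :
  (forall C, regions H C -> homeomorphic C (unit_ball R n)) ->
  euler_char (~` \bigcup_i H i)
    ((#|` fset_set (regions H)|%fset)%:Z * (-1) ^+ n).
Proof.
move=> ballH.
have -> : (#|` fset_set (regions H)|%fset)%:Z * (-1) ^+ n =
    \sum_(C \in regions H) (1 : int) * (-1) ^+ n.
  have finR := regions_finite.
  rewrite fsbig_finite // big_const_seq count_predT.
  by rewrite iter_addr_0 mul1r -mulr_natl natz.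
apply: (euler_char_fsum (C := id)) => [|q|C regC].
- exact: regions_finite.
- by rewrite -fsum_indic_components; apply: eq_fsbigr => C _; rewrite mul1r.
- by apply: euler_char_region => //; exact: ballH.
Qed.

End Arrangement.

Lemma toric_arrangement_forms (R : realType) n m (H : 'I_m -> set (torus R n)) :
  (forall i, toric_hyperplane (H i)) ->
  exists (a : 'M[int]_(m, n)) (b : 'cV[R]_m), forall i x,
    H i (torus_proj x) <-> (map_mx intr a *m x - b) i 0 \is a Num.int.
Proof.
move=> hypH.
have /choice[f fP] : forall i, exists rb : 'rV[int]_n * R, forall x,
    H i (torus_proj x) <-> (map_mx intr rb.1 *m x) 0 0 - rb.2 \is a Num.int.
  by move=> i; have [r [b [_ rbP]]] := toric_hyperplane_form (hypH i);
    exists (r, b).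
exists (\matrix_i (f i).1), (\col_i (f i).2) => i x; rewrite fP.
suff -> : (map_mx intr (f i).1 *m x) 0 0 - (f i).2 =
    (map_mx intr (\matrix_i (f i).1) *m x - \col_i (f i).2) i 0 by [].
by rewrite !mxE; congr (_ - _); apply: eq_bigr => j _; rewrite !mxE.
Qed.

Theorem theorem3p6 (R : realType) (n m : nat) (H : 'I_m -> set (torus R n))
  (hypH : forall i : 'I_m, toric_hyperplane (H i))
  (ballH : forall C : set (torus R n),
     regions H C -> homeomorphic C (unit_ball R n)) :
  finite_set (regions H) /\
  (#|` fset_set (regions H)|%fset)%:Z = (-1) ^+ n * (toric_char_poly H).[0].
Proof.
have [a [b H_form]] := toric_arrangement_forms hypH.
have H_neqT i := toric_hyperplane_neqT (hypH i).
split; first exact: regions_finite H_form.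
rewrite (torus_euler_unique (euler_char_complement_strata H_form H_neqT)
  (euler_char_complement_regions H_form ballH)).
by rewrite mulrCA -expr2 sqrr_sign mulr1.
Qed.
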